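(* Assume that the polynomials $q_i^x$, $q_j^{y,i}$, $q_k^{z,i,j}$ all have property (D). Then the functions $$v^{\blacktriangle,I}_{ijk},\quad v^{\blacktriangle,II,\mathcal N}_{ijk},\quad v^{\blacktriangle,III,\mathcal N}_{ijk}\qquad (i\ge2,\ j,k\ge1,\ i+j+k\le p)$$ together with $v^{\blacktriangle,IV}_{1jk}$ ($j,k\ge1$, $j+k\le p-2$) form a basis of the interior functions of the Nédélec space of second kind $[\mathcal P_{p-1}]^3$ on $\blacktriangle$. Furthermore, if the functions $v^{\blacktriangle,I}_{ijk}$ are used only for $i+j+k\le p-1$ (all the other functions being kept), the resulting set is a basis of the interior functions of the Nédélec space of first kind $R_{p-1}$ on $\blacktriangle$.
   Context: $\mathcal P_m$ is the space of real polynomials of total degree at most $m$. The reference tetrahedron $\blacktriangle$ has vertices $V_1=(-1,-1,-1)$, $V_2=(1,-1,-1)$, $V_3=(0,1,-1)$, $V_4=(0,0,1)$. The interior functions of a polynomial subspace of $H(\mathrm{curl},\blacktriangle)$ are those elements whose tangential trace vanishes on $\partial\blacktriangle$. Univariate polynomial families: $q_i^x$ of exact degree $i$ ($i\ge2$) with $q_i^x(\pm1)=0$; $q_j^{y,i}$ of exact degree $j$ ($i,j\ge1$) with $q_j^{y,i}(-1)=0$; $q_k^{z,i,j}$ of exact degree $k$ ($i,j,k\ge1$) with $q_k^{z,i,j}(-1)=0$. A polynomial $q$ of degree $n$ has property (D) if $\chi q'(\chi)-n\,q(\chi)$ is a polynomial of degree at most $n-1$ in $\chi$. Auxiliary functions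 (polynomials in $x,y,z$): $f_i=q_i^x\!\left(\frac{4x}{1-2y-z}\right)\left(\frac{1-2y-z}{4}\right)^i$, $g_{i,j}=q_j^{y,i}\!\left(\frac{2y}{1-z}\right)\left(\frac{1-z}{2}\right)^j$, $h_{i,j,k}=q_k^{z,i,j}(z)$. Functions: $v^{\blacktriangle,I}_{ijk}=\nabla(f_i g_{i,j}h_{i,j,k})$, $v^{\blacktriangle,II,\mathcal N}_{ijk}=j\,(\nabla f_i)g_{i,j}h_{i,j,k}-i\,f_i(\nabla g_{i,j})h_{i,j,k}$, $v^{\blacktriangle,III,\mathcal N}_{ijk}=k\,(\nabla f_i)g_{i,j}h_{i,j,k}-i\,f_i g_{i,j}\nabla h_{i,j,k}$, $v^{\blacktriangle,IV}_{1jk}=v^{\mathcal N_0}_{[1,2]}\,g_{1,j}h_{1,j,k}$, where $v^{\mathcal N_0}_{[1,2]}=-\tfrac18(1-2y-z,\,2x,\,x)^\top$ is the lowest order Nédélec function of first kind of the edge from $V_1$ to $V_2$. The Nédélec space of first kind is $R_k=[\mathcal P_{k-1}]^3\oplus S_k$ with $S_k=\{p\in[\tilde{\mathcal P}_k]^3:\vec r\cdot p=0\}$, $\vec r=(x,y,z)^\top$, where $[\tilde{\mathcal P}_k]^3$ consists of the vector fields with components homogeneous of degree exactly $k$ (or zero). The Nédélec space of second kind is the full space $[\mathcal P_k]^3$. *)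

(* Defs.v *)
From mathcomp Require Import all_boot all_order all_algebra.
From mathcomp Require Import reals.
From mathcomp Require Import mpoly.

Set Implicit Arguments.
Unset Strict Implicit.
Unset Printing Implicit Defensive.

Import Order.TTheory GRing.Theory Num.Theory.
Local Open Scope ring_scope.

Definition ix : 'I_3 := @Ordinal 3 0 isT.
Definition iy : 'I_3 := @Ordinal 3 1 isT.
Definition iz : 'I_3 := @Ordinal 3 2 isT.

Definition vec3 (T : Type) (a b c : T) : {ffun 'I_3 -> T} :=
  [ffun d => tnth [tuple a; b; c] d].

Definition dot (T : pzRingType) (u v : {ffun 'I_3 -> T}) : T :=
  \sum_d u d * v d.

Definition cross (T : pzRingType) (u v : {ffun 'I_3 -> T}) :
    {ffun 'I_3 -> T} :=
  vec3 (u iy * v iz - u iz * v iy)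
       (u iz * v ix - u ix * v iz)
       (u ix * v iy - u iy * v ix).

(* [s] is a basis of the subspace [U] of the (possibly infinite dimensional)
   space [V].  The family [s] is indexed by position, so a repeated vector
   makes it linearly dependent. *)
Definition is_basis (K : nzRingType) (V : lmodType K) (U : V -> Prop)
    (s : seq V) : Prop :=
  [/\ forall v, v \in s -> U v,
      forall c : 'I_(size s) -> K,
        \sum_i c i *: s`_i = 0 -> forall i, c i = 0
    & forall v, U v -> exists c : 'I_(size s) -> K, v = \sum_i c i *: s`_i].

Section Fields.
Variable R : realType.

Local Notation poly3 := {mpoly R[3]}.
Local Notation point := {ffun 'I_3 -> R}.
Local Notation field3 := {ffun 'I_3 -> poly3}.

Definition X : poly3 := 'X_ix.
Definition Y : poly3 := 'X_iy.
Definition Z : poly3 := 'X_iz.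

Definition grad (u : poly3) : field3 := [ffun d => mderiv d u].

Definition pmul (a : poly3) (v : field3) : field3 := [ffun d => a * v d].

Definition veval (v : field3) (x : point) : point := [ffun d => (v d).@[x]].

Definition vertex (m : 'I_4) : point :=
  tnth [tuple vec3 (-1) (-1) (-1);
              vec3 1 (-1) (-1);
              vec3 0 1 (-1);
              vec3 0 0 1] m.

(* Barycentric coordinates; the face is the closed one opposite to [m]. *)
Definition on_face (m : 'I_4) (x : point) : Prop :=
  exists lam : 'I_4 -> R,
    [/\ forall l, 0 <= lam l, \sum_l lam l = 1, lam m = 0
      & forall d, x d = \sum_l lam l * vertex l d].

(* A nonzero normal of that face.  It is neither normalized nor oriented
   outwards: this does not affect the vanishing of the tangential trace. *)
Definition normal (m : 'I_4) : point :=
  let e (l : 'I_3) := vertex (lift m l) in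
  cross (e iy - e ix) (e iz - e ix).

Definition zero_tangential_trace (v : field3) : Prop :=
  forall (m : 'I_4) (x : point), on_face m x ->
    cross (normal m) (veval v x) = 0.

Definition interior (U : field3 -> Prop) (v : field3) : Prop :=
  U v /\ zero_tangential_trace v.

Definition nedelec2 (k : nat) (v : field3) : Prop :=
  forall d, (msize (v d) <= k.+1)%N.

Definition homog_orth (k : nat) (v : field3) : Prop :=
  (forall d, v d \is k.-homog) /\ dot (vec3 X Y Z) v = 0.

(* [msize u <= k] means total degree at most [k - 1], and [u = 0] if [k = 0].
   The sum is direct for degree reasons. *)
Definition nedelec1 (k : nat) (v : field3) : Prop :=
  exists u w : field3,
    [/\ forall d, (msize (u d) <= k)%N, homog_orth k w & v = u + w].

Definition exact_degree (n : nat) (q : {poly R}) : Prop := size q = n.+1.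

Definition property_D (q : {poly R}) : Prop :=
  let n := (size q).-1 in
  (size ('X * q^`() - n%:R *: q)%R <= n)%N.

(* The polynomial [q(s / t) * t ^ n], for [q] of degree at most [n]; the
   lemmas [homogenizeE], [aux_fE] and [aux_gE] give back the quotient form. *)
Definition homogenize (n : nat) (q : {poly R}) (s t : poly3) : poly3 :=
  \sum_(m < n.+1) q`_m *: (s ^+ m * t ^+ (n - m)).

Lemma homogenizeE n (q : {poly R}) (s t : poly3) (x : 'I_3 -> R) :
    (size q <= n.+1)%N -> t.@[x] != 0 ->
  (homogenize n q s t).@[x] = q.[s.@[x] / t.@[x]] * t.@[x] ^+ n.
Proof.
move=> szq t0; rewrite /homogenize raddf_sum (horner_coef_wide _ szq) mulr_suml.
apply: eq_bigr => m _; rewrite /= mevalZ mevalM !rmorphXn /= expr_div_n -!mulrA.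
congr (_ * (_ * _)).
by rewrite mulrC expfB_cond // (negPf t0) -ltnS ltn_ord.
Qed.

Definition aux_f (qx : nat -> {poly R}) (i : nat) : poly3 :=
  homogenize i (qx i) X (4^-1 *: (1 - 2%:R *: Y - Z)).

Definition aux_g (qy : nat -> nat -> {poly R}) (i j : nat) : poly3 :=
  homogenize j (qy i j) Y (2^-1 *: (1 - Z)).

Definition aux_h (qz : nat -> nat -> nat -> {poly R}) (i j k : nat) : poly3 :=
  (map_poly (@mpolyC 3 R) (qz i j k)).[Z].

Lemma aux_fE (qx : nat -> {poly R}) i (v : 'I_3 -> R) (x := v ix) (y := v iy) (z := v iz) :
    (size (qx i) <= i.+1)%N -> 1 - 2 * y - z != 0 ->
  (aux_f qx i).@[v] =
  (qx i).[4 * x / (1 - 2 * y - z)] * ((1 - 2 * y - z) / 4) ^+ i.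
Proof.
move=> szq t0.
have tE : (4^-1 *: (1 - 2%:R *: Y - Z)).@[v] = (1 - 2 * y - z) / 4.
  by rewrite mevalZ !mevalB mevalZ meval1 !mevalXU mulrC.
rewrite /aux_f homogenizeE // tE; last by rewrite mulf_neq0 ?invr_eq0 ?pnatr_eq0.
by rewrite mevalXU invf_div mulrA [_ * 4]mulrC.
Qed.

Lemma aux_gE (qy : nat -> nat -> {poly R}) i j (v : 'I_3 -> R) (y := v iy) (z := v iz) :
    (size (qy i j) <= j.+1)%N -> 1 - z != 0 ->
  (aux_g qy i j).@[v] = (qy i j).[2 * y / (1 - z)] * ((1 - z) / 2) ^+ j.
Proof.
move=> szq t0.
have tE : (2^-1 *: (1 - Z)).@[v] = (1 - z) / 2.
  by rewrite mevalZ mevalB meval1 mevalXU mulrC.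
rewrite /aux_g homogenizeE // tE; last by rewrite mulf_neq0 ?invr_eq0 ?pnatr_eq0.
by rewrite mevalXU invf_div mulrA [_ * 2]mulrC.
Qed.

Lemma aux_hE (qz : nat -> nat -> nat -> {poly R}) i j k (v : 'I_3 -> R) :
  (aux_h qz i j k).@[v] = (qz i j k).[v iz].
Proof.
rewrite /aux_h -horner_map -map_poly_comp_id0 /= ?mevalXU ?meval0 //.
by rewrite map_poly_id // => c _; rewrite /= mevalC.
Qed.

Section Functions.
Variables (qx : nat -> {poly R}) (qy : nat -> nat -> {poly R}).
Variable qz : nat -> nat -> nat -> {poly R}.

Local Notation f := (aux_f qx).
Local Notation g := (aux_g qy).
Local Notation h := (aux_h qz).

Definition fun_I (i j k : nat) : field3 := grad (f i * g i j * h i j k).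

Definition fun_II (i j k : nat) : field3 :=
  j%:R *: pmul (g i j * h i j k) (grad (f i))
  - i%:R *: pmul (f i * h i j k) (grad (g i j)).

Definition fun_III (i j k : nat) : field3 :=
  k%:R *: pmul (g i j * h i j k) (grad (f i))
  - i%:R *: pmul (f i * g i j) (grad (h i j k)).

(* Lowest order edge function of the edge from [vertex 0] to [vertex 1]. *)
Definition edge_fun12 : field3 :=
  (- (1 / 8)) *: vec3 (1 - 2%:R *: Y - Z) (2%:R *: X) X.

Definition fun_IV (j k : nat) : field3 :=
  pmul (g 1 j * h 1 j k) edge_fun12.

End Functions.

(* Bounding each index by [n] loses nothing, since it is implied by the
   bound on the sum. *)
Definition index3 (n : nat) : {set 'I_n.+1 * 'I_n.+1 * 'I_n.+1} :=
  [set t : 'I_n.+1 * 'I_n.+1 * 'I_n.+1 |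
    [&& 2 <= t.1.1, 1 <= t.1.2, 1 <= t.2 & t.1.1 + t.1.2 + t.2 <= n]%N].

Definition index2 (n : nat) : {set 'I_n.+1 * 'I_n.+1} :=
  [set t : 'I_n.+1 * 'I_n.+1 | [&& 1 <= t.1, 1 <= t.2 & t.1 + t.2 <= n]%N].

Definition family3 (F : nat -> nat -> nat -> field3) (n : nat) : seq field3 :=
  [seq F t.1.1 t.1.2 t.2 | t : 'I_n.+1 * 'I_n.+1 * 'I_n.+1 in index3 n].

Definition family2 (F : nat -> nat -> field3) (n : nat) : seq field3 :=
  [seq F t.1 t.2 | t : 'I_n.+1 * 'I_n.+1 in index2 n].

End Fields.

(* Main.v *)
Require Import Defs.
From mathcomp Require Import all_boot all_order all_algebra.
From mathcomp Require Import reals ring lra zify.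
From mathcomp Require Import mpoly.

(**
With respect to the degree-lexicographic order with x > y > z, the factors
f_i, g_ij, h_ijk have the leading monomials x^i, y^j, z^k.  Up to an invertible
change of basis the families I, II, III are (grad f) g h, f (grad g) h and
f g (grad h), and the matrix whose rows are their components is triangular:
the x-components of the first fields together with those of type IV, the
y-components of the second ones and the z-components of the third ones have
pairwise distinct leading monomials.  This gives linear independence.

For spanning, a vanishing tangential trace amounts to divisibility of the
components of (grad lambda_m) x v by the barycentric coordinate lambda_m, for
each face m.  It forces the leading monomial of v_x to be one of those in the
family (the case without x uses that v_x vanishes on the edge x = 0, 2y = 1 - z
common to the two faces at which f vanishes); subtracting reduces v_x to 0, and
then v_y and v_z in the same way.

A field of degree at most k lies in the first kind space R_k if and only if
r . v has degree at most k.  By Euler's identity this holds for the fields II,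
III, IV, whereas r . grad u has the same leading monomial as u, which excludes
exactly the gradients of top degree.
*)

Set Implicit Arguments.
Unset Strict Implicit.
Unset Printing Implicit Defensive.

Import Order.TTheory GRing.Theory Num.Theory.
Local Open Scope ring_scope.

(** * Leading monomials and the linear independence they give *)

Section LeadingMonomials.
Variables (n : nat) (R : idomainType).
Implicit Types (p q : {mpoly R[n]}) (m : 'X_{1..n}).

Lemma mlead_eq p m :
  p@_m != 0 -> (forall m', m' \in msupp p -> (m' <= m)%O) -> mlead p = m.
Proof.
move=> pm le_m; apply/le_anti; rewrite msupp_le_mlead ?mcoeff_msupp // andbT.
by apply/le_m/mlead_supp; apply: contraNneq pm => ->; rewrite mcoeff0.
Qed.

Lemma mlead_sum_lt (I : Type) (r : seq I) (P : pred I) (F : I -> {mpoly R[n]}) m :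
  (0%MM < m)%O -> (forall i, P i -> (mlead (F i) < m)%O) ->
  (mlead (\sum_(i <- r | P i) F i) < m)%O.
Proof.
move=> m0 Fm; apply: (big_ind (fun p => (mlead p < m)%O)) => // [|p q pm qm].
  by rewrite mlead0.
by apply: le_lt_trans (mleadD_le _ _) _; rewrite ltUx pm qm.
Qed.

(** In characteristic zero the leading coefficient is multiplied by a nonzero integer, and adding
    [U_(i)] preserves the monomial order, so no other term of the derivative overtakes the shifted
    leading one. *)
Lemma mlead_mderiv (i : 'I_n) p : [pchar R] =i pred0 -> (0 < mlead p i)%N ->
  mderiv i p != 0 /\ mlead (mderiv i p) = (mlead p - U_(i))%MM.
Proof.
move=> ch0 m_i.
have p0 : p != 0 by apply: contraTneq m_i => ->; rewrite mlead0 mnm0E.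
have mK : (mlead p - U_(i) + U_(i))%MM = mlead p.
  by apply: submK; apply/mnm_lepP => j; rewrite mnm1E; case: eqP => // <-.
have c0 : (mderiv i p)@_(mlead p - U_(i)) != 0.
  rewrite mcoeff_deriv mK -mulr_natr mulf_neq0 ?mleadc_eq0 //.
  by rewrite ((pcharf0P R).1 ch0).
split; first by apply: contraNneq c0 => ->; rewrite mcoeff0.
apply: mlead_eq => // m' m'_supp.
rewrite -(lemc_add2l _ _ U_(i)) mK; apply: msupp_le_mlead.
rewrite mcoeff_msupp; apply: contraTneq m'_supp => c.
by rewrite mcoeff_msupp mcoeff_deriv c mul0rn negbK.
Qed.

Lemma seq_argmax (T : eqType) d (O : orderType d) (f : T -> O) (s : seq T) :
  s != [::] -> exists2 x, x \in s & forall y, y \in s -> (f y <= f x)%O.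
Proof.
elim: s => // x [|y s] IH _; first by exists x => [|y]; rewrite inE // => /eqP->.
have [//|z zs zmax] := IH.
have [le|lt] := leP (f x) (f z).
  by exists z => [|t]; rewrite inE ?zs ?orbT // => /predU1P[->|/zmax].
exists x => [|t]; rewrite inE ?eqxx // => /predU1P[->//|/zmax le].
exact: le_trans le (ltW lt).
Qed.

Lemma free_mlead (T : eqType) (e : seq T) (P : T -> {mpoly R[n]}) (c : T -> R) k :
    uniq e -> {in e, forall t, P t != 0} ->
    {in e &, injective (fun t => mlead (P t))} ->
    {in e, forall t, k <= mdeg (mlead (P t))}%N ->
    (msize (\sum_(t <- e) c t *: P t) <= k)%N ->
  {in e, forall t, c t = 0}.
Proof.
move=> ue P0 injP degP szS t te; apply/eqP/negP => /negP ct.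
pose s := [seq t <- e | c t != 0].
have s0 : s != [::].
  by apply/eqP => /(congr1 (fun s => t \in s)); rewrite mem_filter ct te.
have [x xs xmax] := seq_argmax (fun t => mlead (P t)) s0.
move: xs; rewrite mem_filter => /andP[cx xe].
have := leq_trans szS (degP x xe); apply/negP; rewrite -ltnNge.
apply: msize_mdeg_lt; rewrite mcoeff_msupp raddf_sum /= (bigD1_seq x) //=.
rewrite big1_seq ?addr0 => [|y /andP[yx ye]].
  by rewrite mcoeffZ mulf_neq0 // mleadc_eq0 P0.
rewrite mcoeffZ; have [->|cy] := eqVneq (c y) 0; first by rewrite mul0r.
rewrite mcoeff_gt_mlead ?mulr0 // lt_neqAle xmax ?mem_filter ?cy // andbT.
by apply: contra_neq yx; apply: injP.
Qed.

End LeadingMonomials.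

(** * Divisibility by a polynomial and reduction modulo it *)

Section Divisibility.
Variables (n : nat) (R : idomainType).
Implicit Types (l p q : {mpoly R[n]}).

Definition mdvd l p := exists c, p = c * l.

Lemma mdvd0 l : mdvd l 0.
Proof. by exists 0; rewrite mul0r. Qed.

Lemma mdvdD l p q : mdvd l p -> mdvd l q -> mdvd l (p + q).
Proof. by move=> [a ->] [b ->]; exists (a + b); rewrite mulrDl. Qed.

Lemma mdvd_mull l p q : mdvd l p -> mdvd l (q * p).
Proof. by move=> [a ->]; exists (q * a); rewrite mulrA. Qed.

Lemma mdvd_mulr l p q : mdvd l p -> mdvd l (p * q).
Proof. by rewrite mulrC; apply: mdvd_mull. Qed.

Lemma mdvdN l p : mdvd l p -> mdvd l (- p).
Proof. by rewrite -mulN1r; apply: mdvd_mull. Qed.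

Lemma mdvdB l p q : mdvd l p -> mdvd l q -> mdvd l (p - q).
Proof. by move=> lp /mdvdN; apply: mdvdD. Qed.

Lemma mdvdZ l p (c : R) : mdvd l p -> mdvd l (c *: p).
Proof. by rewrite -mul_mpolyC; apply: mdvd_mull. Qed.

Lemma mdvd_mlead l p : p != 0 -> mdvd l p -> (mlead l <= mlead p)%MM.
Proof.
move=> p0 [c def_p]; move: p0; rewrite {}def_p mulf_eq0 negb_or => /andP[c0 l0].
by rewrite mleadM // lem_addl.
Qed.

(* Multiplicativity of [p |-> p \mPo lq] reduces this to the variables. *)
Lemma mdvd_comp l (lq : n.-tuple {mpoly R[n]}) p :
  (forall i, mdvd l ('X_i - tnth lq i)) -> mdvd l (p - (p \mPo lq)).
Proof.
move=> Xl; elim/mpolyind: p => [|c m p _ _ IH].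
  by rewrite comp_mpoly0 subrr; apply: mdvd0.
rewrite comp_mpolyD comp_mpolyZ opprD addrACA -scalerBr.
apply: mdvdD => //; apply: mdvdZ.
rewrite comp_mpolyX mpolyXE_id; apply: (big_ind2 (fun p q => mdvd l (p - q))).
- by rewrite subrr; apply: mdvd0.
- move=> p1 p2 q1 q2 dp dq.
  have -> : p1 * q1 - p2 * q2 = (p1 - p2) * q1 + p2 * (q1 - q2) by ring.
  by apply: mdvdD; [apply: mdvd_mulr | apply: mdvd_mull].
- move=> i _; rewrite subrXX; exact/mdvd_mulr/Xl.
Qed.

End Divisibility.

(** * Total degree, Euler's identity and homogeneous components *)

Section Degrees.
Variables (n : nat) (R : idomainType).
Implicit Types (p q : {mpoly R[n]}).

Lemma msize_leP p k :
  reflect (forall m, m \in msupp p -> (mdeg m < k)%N) (msize p <= k)%N.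
Proof.
rewrite msizeE; apply: (iffP (bigmax_leqP_seq _ _ _ _)) => H m mp; first exact: H.
by move=> _; apply: H.
Qed.

Lemma msizeD_leq p q k :
  (msize p <= k)%N -> (msize q <= k)%N -> (msize (p + q) <= k)%N.
Proof.
by move=> pk qk; apply: leq_trans (msizeD_le _ _) _; rewrite geq_max pk.
Qed.

Lemma msizeB_leq p q k :
  (msize p <= k)%N -> (msize q <= k)%N -> (msize (p - q) <= k)%N.
Proof. by move=> pk qk; apply: msizeD_leq => //; rewrite msizeN. Qed.

Lemma msizeZ_leq p k (c : R) : (msize p <= k)%N -> (msize (c *: p) <= k)%N.
Proof. exact/leq_trans/msizeZ_le. Qed.

Lemma msize_sum_leq (I : Type) (r : seq I) (P : pred I) (F : I -> {mpoly R[n]}) k :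
  (forall i, P i -> (msize (F i) <= k)%N) ->
  (msize (\sum_(i <- r | P i) F i) <= k)%N.
Proof.
move=> Fk; apply: (big_ind (fun p => (msize p <= k)%N)) => //.
  by rewrite mmeasure0.
by move=> p q; apply: msizeD_leq.
Qed.

(** As [msize] is the degree plus one, the sizes of two nonzero factors add up to one more than the
    size of the product; the second hypothesis absorbs this unit. *)
Lemma msizeM_leq p q a b :
  (msize p <= a)%N -> (msize q <= b.+1)%N -> (msize (p * q) <= a + b)%N.
Proof.
have [->|p0] := eqVneq p 0; first by rewrite mul0r mmeasure0.
have [->|q0] := eqVneq q 0; first by rewrite mulr0 mmeasure0.
by rewrite msizeM //; lia.
Qed.

Lemma msizeX_leq p k : (msize p <= 2)%N -> (msize (p ^+ k) <= k.+1)%N.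
Proof.
move=> p2; elim: k => [|k IH]; first by rewrite expr0 msize1.
by rewrite exprSr -[k.+2]addn1; apply: msizeM_leq.
Qed.

Lemma msize_mderiv_leq i p k : (msize p <= k.+1)%N -> (msize (mderiv i p) <= k)%N.
Proof.
move=> /msize_leP pk; apply/msize_leP => m; rewrite mcoeff_msupp mcoeff_deriv => c.
have/pk : (m + U_(i))%MM \in msupp p.
  by rewrite mcoeff_msupp; apply: contraNneq c => ->; rewrite mul0rn.
by rewrite mdegD mdeg1 addn1.
Qed.

Definition euler p : {mpoly R[n]} := \sum_i 'X_i * mderiv i p.

Lemma eulerX m : euler 'X_[m] = (mdeg m)%:R *: 'X_[m].
Proof.
rewrite /euler mdegE natr_sum scaler_suml; apply: eq_bigr => i _.
rewrite mderivX -scalerAr -mpolyXD; have [->|mi] := posnP (m i); first by rewrite !scale0r.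
rewrite addmC submK //; apply/mnm_lepP => j; rewrite mnm1E; case: eqP => // <-.
by rewrite lt0n -lt0n.
Qed.

(** The operator multiplies a monomial of degree [d] by [d - k], which kills the terms of degree
    exactly [k]. *)
Lemma euler_homog p k :
  (msize p <= k.+1)%N -> (msize (euler p - k%:R *: p) <= k)%N.
Proof.
move=> /msize_leP pk; rewrite {1 2}[p]mpolyE.
rewrite /euler (eq_bigr (fun i =>
  \sum_(m <- msupp p) p@_m *: ('X_i * mderiv i 'X_[m]))); last first.
  move=> i _; rewrite raddf_sum mulr_sumr; apply: eq_bigr => m _ /=.
  by rewrite mderivZ scalerAr.
rewrite exchange_big scaler_sumr -sumrB /= big_seq.
apply: msize_sum_leq => m /pk mk; rewrite -scaler_sumr -/(euler _) eulerX.
rewrite [k%:R *: _]scalerA [k%:R * _]mulrC -scalerA -scalerBr -scalerBl.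
apply: msizeZ_leq; move: mk; rewrite ltnS leq_eqVlt => /predU1P[->|mk].
  by rewrite subrr scale0r mmeasure0.
by apply: msizeZ_leq; rewrite msizeX.
Qed.

Lemma dhomog_msize_leq p k : p \is k.-homog -> (msize p <= k.+1)%N.
Proof. by move=> /dhomogP hp; apply/msize_leP => m /hp ->. Qed.

Lemma dhomog_msize_eq0 p k : p \is k.-homog -> (msize p <= k)%N -> p = 0.
Proof.
move=> /dhomogP hp /msize_leP pk; apply/eqP/negPn/negP => p0.
by have := pk _ (mlead_supp p0); rewrite hp ?mlead_supp // ltnn.
Qed.

Lemma msize_pihomog p k : (msize p <= k.+1)%N -> (msize (p - pihomog mdeg k p) <= k)%N.
Proof.
move=> pk; rewrite {1}(pihomog_partitionE pk) big_ord_recr /= addrK.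
apply: msize_sum_leq => i _.
exact: leq_trans (dhomog_msize_leq (pihomogP _ _ _)) (ltn_ord i).
Qed.

End Degrees.

(** * Polynomials that vanish on an infinite grid *)

Section Vanishing.
Variable R : idomainType.

Lemma poly_grid_eq0 (p : {poly R}) (u : nat -> R) :
  injective u -> (forall k, p.[u k] = 0) -> p = 0.
Proof.
move=> u_inj pu; apply: (@roots_geq_poly_eq0 _ p [seq u k | k <- iota 0 (size p)]).
- by apply/allP => x /mapP[k _ ->]; apply/rootP.
- by rewrite map_inj_uniq ?iota_uniq.
- by rewrite size_map size_iota.
Qed.

Lemma meval_muni n (p : {mpoly R[n.+1]}) (v : 'I_n.+1 -> R) :
  p.@[v] = (map_poly (meval (fun i => v (widen_ord (leqnSn n) i))) (muni p)).[v ord_max].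
Proof.
rewrite muniE raddf_sum horner_sum {1}[p]mpolyE raddf_sum /=.
apply: eq_bigr => m _; rewrite mevalZ -!mul_polyC rmorphM /= map_polyC map_polyXn.
rewrite hornerM hornerC hornerXn -[X in _ = X * _]/(meval _ _) mevalZ !mevalX -mulrA; congr (_ * _).
rewrite big_ord_recr /=; congr (_ * _).
by apply: eq_bigr => i _; rewrite mnmE.
Qed.

(** A monomial is determined by its last exponent and the tuple of the others, so no two terms of
    [p] merge in [muni p]. *)
Lemma muni_eq0 n (p : {mpoly R[n.+1]}) : muni p = 0 -> p = 0.
Proof.
move=> p0; apply/mpolyP => m; rewrite mcoeff0.
pose tl (m : 'X_{1..n.+1}) := [multinom m (widen_ord (leqnSn n) i) | i < n].
have : (muni p)`_(m ord_max)@_(tl m) = 0 by rewrite p0 coef0 mcoeff0.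
rewrite muniE coef_sum raddf_sum /= -/tl.
have [mp|/memN_msupp_eq0->//] := boolP (m \in msupp p).
rewrite (bigD1_seq m) ?msupp_uniq //= big1 => [|m' m'm].
  by rewrite !coefZ coefXn eqxx mulr1 mcoeffZ mcoeffX eqxx mulr1 addr0.
rewrite coefZ coefXn; case: eqP => [em|_]; last by rewrite mulr0 mcoeff0.
rewrite mulr1 mcoeffZ mcoeffX; case: eqP => [et|_]; last by rewrite mulr0.
case/eqP: m'm; apply/mnmP => i; have [->//|i_max] := eqVneq i ord_max.
have i_n : (i < n)%N.
  by rewrite ltn_neqAle -ltnS ltn_ord andbT; apply: contraNneq i_max => e; apply/eqP/val_inj.
have -> : i = widen_ord (leqnSn n) (Ordinal i_n) by apply: val_inj.
by have /mnmP/(_ (Ordinal i_n)) := et; rewrite !mnmE.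
Qed.

(** Induction on the number of variables: with the first ones fixed, the polynomial in the last one
    has infinitely many roots, so its coefficients vanish on the grid of one dimension less. *)
Lemma mpoly_grid_eq0 n (p : {mpoly R[n]}) (u : nat -> R) :
  injective u -> (forall k : 'I_n -> nat, p.@[fun i => u (k i)] = 0) -> p = 0.
Proof.
move=> u_inj; elim: n p => [|n IH] p p0.
  have := p0 (fun=> 0%N); rewrite [p]msize1_polyC ?mevalC => [->|]; first exact: mpolyC0.
  by apply/msize_leP => m _; rewrite mdegE big_ord0.
apply/muni_eq0/polyP => j; rewrite coef0; apply: IH => k.
have /polyP/(_ j) : map_poly (meval (fun i => u (k i))) (muni p) = 0.
  apply: (poly_grid_eq0 u_inj) => t.
  (* The grid point with index [k] in the first variables and [t] in the last one. *)
  have := p0 (fun i => if insub (i : nat) is Some i' then k i' else t).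
  rewrite meval_muni /= insubF ?ltnn // => <-; congr _.[_].
  apply: eq_map_poly => q; apply: meval_eq => i /=.
  by rewrite insubT // => i_n; congr (u (k _)); apply: val_inj.
by rewrite coef_map coef0.
Qed.

End Vanishing.

(** * Spans and freeness of families over a sequence of indices *)

Section Spans.
Variables (K : nzRingType) (V : lmodType K) (T : eqType) (F : T -> V).
Implicit Types (e : seq T).

Definition in_span e v := exists c : T -> K, v = \sum_(t <- e) c t *: F t.

Lemma in_span0 e : in_span e 0.
Proof. by exists (fun=> 0); rewrite big1 // => t _; rewrite scale0r. Qed.

Lemma in_spanD e v w : in_span e v -> in_span e w -> in_span e (v + w).
Proof.
move=> [c ->] [d ->]; exists (fun t => c t + d t).
by rewrite -big_split; apply: eq_bigr => t _; rewrite scalerDl.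
Qed.

Lemma in_spanZ e a v : in_span e v -> in_span e (a *: v).
Proof.
move=> [c ->]; exists (fun t => a * c t).
by rewrite scaler_sumr; apply: eq_bigr => t _; rewrite scalerA.
Qed.

Lemma in_spanB e v w : in_span e v -> in_span e w -> in_span e (v - w).
Proof. by move=> ev ew; rewrite -scaleN1r; apply/in_spanD/in_spanZ. Qed.

Lemma in_span_mem e t : uniq e -> t \in e -> in_span e (F t).
Proof.
move=> ue te; exists (fun s => (s == t)%:R).
rewrite (bigD1_seq t) //= eqxx scale1r big1 ?addr0 // => s /negPf->.
by rewrite scale0r.
Qed.

Definition lin_free e := forall c : T -> K,
  \sum_(t <- e) c t *: F t = 0 -> {in e, forall t, c t = 0}.

Lemma lin_free_sub e e' : uniq e -> uniq e' -> {subset e' <= e} ->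
  lin_free e -> lin_free e'.
Proof.
move=> ue ue' sub free c c0 t te'.
have := free (fun t => if t \in e' then c t else 0).
suff -> : \sum_(t <- e) (if t \in e' then c t else 0) *: F t = 0.
  by move=> /(_ erefl t (sub t te')); rewrite te'.
rewrite -[RHS]c0 (bigID (mem e')) /= [X in _ + X]big1 => [|i /negPf->]; last first.
  by rewrite scale0r.
rewrite addr0 -big_filter (perm_big e') /=.
  by apply: eq_big_seq => i ->.
apply: uniq_perm; rewrite ?filter_uniq // => i; rewrite mem_filter.
by case: (boolP (i \in e')) => // /sub.
Qed.

(** In [is_basis] the coefficients belong to positions, in [lin_free] and [in_span] to indices. As
    [e] has no repetition the two correspond, and equal values of [F] at distinct indices are still
    detected. *)
Lemma is_basis_map (U : V -> Prop) e : uniq e -> {in e, forall t, U (F t)} ->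
  lin_free e -> (forall v, U v -> in_span e v) -> is_basis U (map F e).
Proof.
move=> ue eU free span.
have sumE (t0 : T) (c : 'I_(size (map F e)) -> K) (c' : T -> K) :
    (forall i, c i = c' (nth t0 e i)) ->
    \sum_i c i *: (map F e)`_i = \sum_(t <- e) c' t *: F t.
  move=> cE; rewrite (big_nth t0) big_mkord -(size_map F).
  by apply: eq_bigr => i _; rewrite cE (nth_map t0) // -(size_map F).
split=> [v /mapP[t te ->]|c c0 i|v Uv]; first exact: eU.
  have [t0 _] : exists t0 : T, true.
    by move: (i : nat) (ltn_ord i) => k; case: (e) => // t0; exists t0.
  have [c' c'E] : exists c' : T -> K, forall i, c i = c' (nth t0 e i).
    (* Outside [e] the index equals the length of the sequence, so that [insub] fails and the
       default 0 is taken. *)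
    exists (fun t => if insub (index t e) is Some j then c j else 0) => j.
    have je : (j < size e)%N by rewrite -(size_map F).
    rewrite index_uniq // insubT ?size_map // => j'.
    by congr (c _); apply: val_inj.
  rewrite c'E; apply: free; first by rewrite -(sumE t0 c).
  by rewrite mem_nth // -(size_map F).
have [c ->] := span _ Uv; have [e0|] := eqVneq (size e) 0%N.
  by exists (fun=> 0); rewrite (size0nil e0) big_ord0 big_nil.
case: (e) sumE => // t0 l sumE _; exists (fun i => c (nth t0 (t0 :: l) i)).
exact/esym/(sumE t0).
Qed.

End Spans.

(** * The tangential trace and barycentric coordinates *)

Section TangentialTrace.
Variable R : realType.
Local Notation poly3 := {mpoly R[3]}.
Local Notation field3 := {ffun 'I_3 -> poly3}.
Implicit Types (l q : poly3) (v w : field3).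

Lemma ord3P (P : 'I_3 -> Prop) : P ix -> P iy -> P iz -> forall d, P d.
Proof.
move=> Px Py Pz [[|[|[|//]]] d3].
- by have -> : Ordinal d3 = ix by apply: val_inj.
- by have -> : Ordinal d3 = iy by apply: val_inj.
- by have -> : Ordinal d3 = iz by apply: val_inj.
Qed.

Lemma big_ord3 (V : nmodType) (F : 'I_3 -> V) : \sum_d F d = F ix + (F iy + F iz).
Proof.
rewrite !big_ord_recl big_ord0 addr0; congr (F _ + (F _ + F _)); exact: val_inj.
Qed.

Lemma vec3E T (a b c : T) :
  ((vec3 a b c ix = a) * (vec3 a b c iy = b) * (vec3 a b c iz = c))%type.
Proof. by rewrite !ffunE. Qed.

Lemma crossE (T : pzRingType) (u v : {ffun 'I_3 -> T}) :
  ((cross u v ix = u iy * v iz - u iz * v iy) *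
   (cross u v iy = u iz * v ix - u ix * v iz) *
   (cross u v iz = u ix * v iy - u iy * v ix))%type.
Proof. by rewrite !vec3E. Qed.

Lemma crossBr (T : comPzRingType) (u v w : {ffun 'I_3 -> T}) d :
  cross u (v - w) d = cross u v d - cross u w d.
Proof. by move: d; apply: ord3P; rewrite !crossE !ffunE; ring. Qed.

Lemma crossMr (T : comPzRingType) (a : T) (u v w : {ffun 'I_3 -> T}) d :
  (forall e, w e = a * v e) -> cross u w d = a * cross u v d.
Proof. by move=> wE; move: d; apply: ord3P; rewrite !crossE !wE; ring. Qed.

Lemma dotE (T : pzRingType) (u v : {ffun 'I_3 -> T}) :
  dot u v = u ix * v ix + (u iy * v iy + u iz * v iz).
Proof. exact: big_ord3. Qed.

Lemma fieldBE v w d : (v - w) d = v d - w d.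
Proof. by rewrite !ffunE. Qed.

Lemma fieldDE v w d : (v + w) d = v d + w d.
Proof. by rewrite ffunE. Qed.

Lemma fieldZE (c : R) v d : (c *: v) d = c *: v d.
Proof. by rewrite ffunE. Qed.

Lemma pmulE q v d : pmul q v d = q * v d.
Proof. by rewrite ffunE. Qed.

Lemma gradE q d : grad q d = mderiv d q.
Proof. by rewrite ffunE. Qed.

(** For an affine [l], [grad l] is normal to the plane [l = 0], so this is the algebraic form of a
    vanishing tangential trace on that plane. *)
Definition tangential l v := forall d, mdvd l (cross (grad l) v d).

Lemma tangentialB l v w : tangential l v -> tangential l w -> tangential l (v - w).
Proof. move=> lv lw d; rewrite crossBr; apply: mdvdB; [exact: lv | exact: lw]. Qed.

Lemma tangential_pmul l c v : tangential l v -> tangential l (pmul c v).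
Proof.
move=> lv d; rewrite (@crossMr _ c (grad l) v) => [|e]; last by rewrite pmulE.
exact: mdvd_mull.
Qed.

Lemma pmulC (c : R) v : pmul c%:MP v = c *: v.
Proof. by apply/ffunP => d; rewrite !ffunE mul_mpolyC. Qed.

Lemma tangentialZ l (c : R) v : tangential l v -> tangential l (c *: v).
Proof. by rewrite -pmulC; apply: tangential_pmul. Qed.

Lemma tangentialD l v w : tangential l v -> tangential l w -> tangential l (v + w).
Proof.
move=> lv lw; have -> : v + w = v - (-1) *: w by rewrite scaleN1r opprK.
exact/tangentialB/tangentialZ.
Qed.

Lemma tangential_pmul_mdvd l c v : mdvd l c -> tangential l (pmul c v).
Proof.
move=> lc; apply: ord3P; rewrite crossE !pmulE; apply: mdvdB; apply: mdvd_mull;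
  exact: mdvd_mulr.
Qed.

(** By the product rule [grad (c * l)] is [c] times [grad l] plus [l] times [grad c], and the first
    term is parallel to [grad l]. *)
Lemma tangential_grad l q : mdvd l q -> tangential l (grad q).
Proof.
move=> [c ->]; apply: ord3P; rewrite crossE !gradE !mderivM.
- by exists (l^`M(iy) * c^`M(iz) - l^`M(iz) * c^`M(iy)); ring.
- by exists (l^`M(iz) * c^`M(ix) - l^`M(ix) * c^`M(iz)); ring.
- by exists (l^`M(ix) * c^`M(iy) - l^`M(iy) * c^`M(ix)); ring.
Qed.

Local Notation X := (X R).
Local Notation Y := (Y R).
Local Notation Z := (Z R).

(** The coordinate [m] vanishes on the face opposite to [vertex m]. In this numbering [f] vanishes
    on faces 0 and 1, [g] on face 2 and [h] on face 3. *)
Definition bary (m : 'I_4) : poly3 :=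
  tnth [tuple 8^-1 *: (1 - 2 *: Y - Z) - 2^-1 *: X;
              8^-1 *: (1 - 2 *: Y - Z) + 2^-1 *: X;
              4^-1 *: (1 + 2 *: Y - Z);
              2^-1 *: (1 + Z)] m.

Lemma ord4P (P : 'I_4 -> Prop) :
  P (@Ordinal 4 0 isT) -> P (@Ordinal 4 1 isT) -> P (@Ordinal 4 2 isT) ->
  P (@Ordinal 4 3 isT) -> forall m, P m.
Proof.
move=> P0 P1 P2 P3 [[|[|[|[|//]]]] m4]; rewrite (bool_irrelevance m4 isT) //.
Qed.

Definition face0 := @Ordinal 4 0 isT.
Definition face1 := @Ordinal 4 1 isT.
Definition face2 := @Ordinal 4 2 isT.
Definition face3 := @Ordinal 4 3 isT.

Lemma big_ord4 (V : nmodType) (F : 'I_4 -> V) :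
  \sum_m F m = F face0 + (F face1 + (F face2 + F face3)).
Proof.
rewrite !big_ord_recl big_ord0 addr0.
congr (F _ + (F _ + (F _ + F _))); exact: val_inj.
Qed.

Lemma baryE (v : 'I_3 -> R) :
  (((bary face0).@[v] = ((1 - 2 * v iy - v iz) / 8 - v ix / 2)%R) *
   ((bary face1).@[v] = ((1 - 2 * v iy - v iz) / 8 + v ix / 2)%R) *
   ((bary face2).@[v] = ((1 + 2 * v iy - v iz) / 4)%R) *
   ((bary face3).@[v] = ((1 + v iz) / 2)%R))%type.
Proof.
rewrite /bary !(tnth_nth 0) /=.
by do !split; rewrite ?(mevalD, mevalB, mevalN, mevalZ, meval1, mevalXU); ring.
Qed.

Lemma vertexE :
  ((vertex R face0 = vec3 (-1) (-1) (-1)) * (vertex R face1 = vec3 1 (-1) (-1)) *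
   (vertex R face2 = vec3 0 1 (-1)) * (vertex R face3 = vec3 0 0 1))%type.
Proof. by []. Qed.

Lemma on_face_bary m (x : {ffun 'I_3 -> R}) : on_face m x -> (bary m).@[x] = 0.
Proof.
move=> [lam [_ lam1 lamm xE]]; move: lam1 lamm (xE ix) (xE iy) (xE iz).
rewrite !big_ord4 !vertexE !vec3E.
by move: m; apply: ord4P; rewrite baryE => ? ? ? ? ?; lra.
Qed.

Lemma bary_on_face m (x : {ffun 'I_3 -> R}) :
  (forall k, 0 <= (bary k).@[x]) -> (bary m).@[x] = 0 -> on_face m x.
Proof.
move=> x0 xm; exists (fun k => (bary k).@[x]); split=> //.
  by rewrite big_ord4 !baryE; field.
by apply: ord3P; rewrite big_ord4 !baryE !vertexE !vec3E; field.
Qed.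

(* The grid lies near the centre of the reference tetrahedron, so that its
   projection onto the plane [bary m = 0] along a coordinate axis lies in the
   face. *)
Lemma face_vanishing m q :
  (forall x : {ffun 'I_3 -> R}, on_face m x -> q.@[x] = 0) -> mdvd (bary m) q.
Proof.
(* The scalar [a] is the inverse of the coefficient of the variable [j] in [bary m], so that the
   substitution [s] is the projection onto the plane [bary m = 0] along that axis. *)
move=> q0; pose a : R := nth 0 [:: -2; 2; 2; 2] m.
pose j : 'I_3 := nth ix [:: ix; ix; iy; iz] m.
pose s : 3.-tuple poly3 := [tuple 'X_i - (i == j)%:R * a *: bary m | i < 3].
have sE i : tnth s i = 'X_i - (i == j)%:R * a *: bary m by rewrite tnth_mktuple.
have -> : q = q - (q \mPo s).
  suff -> : q \mPo s = 0 by rewrite subr0.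
  (* These values are distinct and lie between 0 and 1/4, which keeps the remaining barycentric
     coordinates of the projected point nonnegative. *)
  pose u k : R := (k + 4)%:R^-1.
  apply: (@mpoly_grid_eq0 _ _ _ u) => [k k' /invr_inj/eqP|k].
    by rewrite eqr_nat eqn_add2r => /eqP.
  have uP i : 0 <= u (k i) <= 4^-1.
    by rewrite invr_ge0 ler0n lef_pV2 ?posrE ?ltr0n ?ler_nat ?addn_gt0 ?leq_addl ?orbT.
  rewrite comp_mpoly_meval; set w := fun i => _.
  rewrite (@meval_eq _ _ _ [ffun i => w i]) => [|i]; last by rewrite ffunE.
  apply: q0; move: (uP ix) (uP iy) (uP iz).
  have wE i : w i = u (k i) - (i == j)%:R * a * (bary m).@[fun i => u (k i)].
    by rewrite /w sE mevalB mevalXU mevalZ.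
  move=> /andP[x0 x4] /andP[y0 y4] /andP[z0 z4].
  have B : forall k', 0 <= (bary k').@[[ffun i => w i]] /\ (bary m).@[[ffun i => w i]] = 0.
    clearbody w; clear s sE uP; move: m @a @j wE; apply: ord4P => a j wE; apply: ord4P;
      rewrite !baryE !ffunE !wE /a /j !baryE /=; lra.
  by apply: bary_on_face => [k'|]; [case: (B k') | case: (B m)].
apply: mdvd_comp => i; rewrite sE subKr -mul_mpolyC.
by apply: mdvd_mull; exists 1; rewrite mul1r.
Qed.

Lemma mderivXU (i j : 'I_3) : mderiv i 'X_j = ((j == i)%:R)%:MP :> poly3.
Proof.
rewrite mderivX mnm1E; case: eqP => [->|_]; last by rewrite scale0r mpolyC0.
have -> : (U_(i) - U_(i) = 0 :> 'X_{1..3})%MM.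
  by apply/mnmP => k; rewrite mnmBE subnn mnm0E.
by rewrite scale1r mpolyX0.
Qed.

Lemma grad_baryE m :
  grad (bary m) = vec3 (nth 0 [:: - 2^-1; 2^-1; 0; 0] m)%:MP
                       (nth 0 [:: - 4^-1; - 4^-1; 2^-1; 0] m)%:MP
                       (nth 0 [:: - 8^-1; - 8^-1; - 4^-1; 2^-1] m)%:MP.
Proof.
apply/ffunP; move: m; apply: ord4P; apply: ord3P;
  rewrite vec3E ffunE /bary (tnth_nth 0) /=
    ?(mderivD, mderivB, mderivN, mderivZ, mderivXU) -mpolyC1 ?mderivC /=
    -!mul_mpolyC -?(mpolyCM, mpolyCN, mpolyCD); congr _%:MP; lra.
Qed.

Lemma grad_bary m : exists2 k : R, k != 0 &
  forall d, grad (bary m) d = (k * normal R m d)%:MP.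
Proof.
(* Six times the volume of the tetrahedron is 8; the sign alternates with the orientation of the
   remaining vertices taken in increasing order. *)
exists (nth 0 [:: - 8^-1; 8^-1; - 8^-1; 8^-1] m).
  by case: m => [[|[|[|[|//]]]] ?]; rewrite /= ?oppr_eq0 invr_eq0 pnatr_eq0.
rewrite grad_baryE; move: m.
apply: ord4P; apply: ord3P; rewrite crossE !vec3E !ffunE /vertex !(tnth_nth 0) /=;
  congr _%:MP; lra.
Qed.

(** The gradient of [bary m] is a nonzero multiple of the normal, and a polynomial that vanishes on
    a face is divisible by its barycentric coordinate. This turns the pointwise condition into an
    algebraic one. *)
Lemma zero_tangential_traceP v :
  zero_tangential_trace v <-> forall m, tangential (bary m) v.
Proof.
have evalE m (x : {ffun 'I_3 -> R}) : exists2 k : R, k != 0 & forall d,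
    (cross (grad (bary m)) v d).@[x] = k * cross (normal R m) (veval v x) d.
  have [k k0] := grad_bary m; move: (normal R m) => N gE; exists k => //.
  have vE d : veval v x d = (v d).@[x] by rewrite ffunE.
  by apply: ord3P; rewrite !crossE !gE mevalB !mevalM !mevalC !vE; ring.
split=> [v0 m d|v0 m x xm].
  apply: face_vanishing => x xm; have [k _ ->] := evalE m x.
  by rewrite (v0 m x xm) ffunE mulr0.
apply/ffunP => d; rewrite [RHS]ffunE; have [k k0 kE] := evalE m x.
apply: (mulfI k0); rewrite -kE mulr0; have [c ->] := v0 m d.
by rewrite mevalM on_face_bary ?mulr0.
Qed.

End TangentialTrace.

(** * Leading monomials and factors of homogenized polynomials *)

Section LeadingData.
Variable R : realType.
Local Notation poly3 := {mpoly R[3]}.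
Local Notation field3 := {ffun 'I_3 -> poly3}.
Implicit Types (p q l s t : poly3) (v w : field3) (m : 'X_{1..3}).
Local Notation X := (X R).
Local Notation Y := (Y R).
Local Notation Z := (Z R).

(** The zero polynomial has leading monomial 1 by convention, hence the separate nonvanishing
    condition. *)
Definition has_lead p m := p != 0 /\ mlead p = m.

Lemma has_leadD p q m : has_lead p m -> (mlead q < m)%O -> has_lead (p + q) m.
Proof.
move=> [p0 pm] qm; have pqm : mlead (p + q) = m by rewrite mleadDl pm.
split=> //; apply: contraTneq qm => pq0; move: pqm; rewrite pq0 mlead0 => <-.
by rewrite -leNgt le0x.
Qed.

Lemma has_leadM p q mp mq :
  has_lead p mp -> has_lead q mq -> has_lead (p * q) (mp + mq)%MM.
Proof. by move=> [p0 <-] [q0 <-]; rewrite /has_lead mulf_neq0 // mleadM. Qed.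

Lemma has_leadZ (c : R) p m : c != 0 -> has_lead p m -> has_lead (c *: p) m.
Proof.
move=> c0 [p0 <-]; split; last exact: mleadZ.
by rewrite -mul_mpolyC mulf_neq0 // mpolyC_eq0.
Qed.

Lemma has_leadX p m k : has_lead p m -> has_lead (p ^+ k) (m *+ k)%MM.
Proof. by move=> [p0 <-]; rewrite /has_lead expf_neq0 // mleadX. Qed.

Lemma has_lead_msize p m : has_lead p m -> msize p = (mdeg m).+1.
Proof. by move=> [p0 <-]; rewrite mlead_deg. Qed.

Lemma has_lead_mderiv i p m : has_lead p m -> (0 < m i)%N ->
  has_lead (mderiv i p) (m - U_(i))%MM.
Proof.
by move=> [p0 <-] mi; apply: mlead_mderiv => //; apply: pchar_num.
Qed.

Lemma has_lead1 : has_lead 1 0%MM.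
Proof. by split; [apply: oner_neq0 | apply: mlead1]. Qed.

Lemma has_leadXU i : has_lead 'X_i U_(i)%MM.
Proof.
split; last exact: mleadXm.
by rewrite -msize_poly_eq0 msizeX.
Qed.

Lemma ltmU (i j : 'I_3) : (j < i)%N -> (U_(i)%MM < U_(j)%MM :> 'X_{1..3})%O.
Proof.
move=> ji; apply/ltmcP; rewrite ?mdeg1 //; exists j => [k kj|].
  rewrite !mnm1E -!val_eqE /= !gtn_eqF //; exact: ltn_trans ji.
by rewrite !mnm1E eqxx -val_eqE /= gtn_eqF.
Qed.

Lemma gt0mU (i : 'I_3) : (0%MM < U_(i)%MM :> 'X_{1..3})%O.
Proof. by apply: lt_mdeg_ltmc; rewrite mdeg0 mdeg1. Qed.

Lemma ltmMn m m' k : (0 < k)%N -> (m < m')%O -> ((m *+ k)%MM < (m' *+ k)%MM)%O.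
Proof.
move=> k0 mm'; elim: k k0 => // -[|k] IH _; first by rewrite !mulm1n.
by rewrite mulmSr [X in (_ < X)%O]mulmSr; apply: ltm_add => //; apply: IH.
Qed.

Lemma mlead_linear_lt (i : 'I_3) (a : R) : (i < 2)%N ->
  (mlead (a *: (1 - Z)) < U_(i)%MM)%O.
Proof.
move=> i2; apply: le_lt_trans (mleadZ_le _ _) _.
apply: le_lt_trans (mleadB_le _ _) _.
by rewrite mlead1 mleadXm ltUx gt0mU ltmU.
Qed.

Lemma has_lead_t (a : R) : a != 0 -> has_lead (a *: (1 - 2 *: Y - Z)) U_(iy)%MM.
Proof.
move=> a0; have -> : a *: (1 - 2 *: Y - Z) = (- 2 * a) *: Y + a *: (1 - Z).
  by rewrite -!mul_mpolyC; ring.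
apply: has_leadD; last exact: mlead_linear_lt.
by apply: has_leadZ; [rewrite mulf_neq0 // oppr_eq0 pnatr_eq0 | apply: has_leadXU].
Qed.

Lemma has_lead_s (a : R) : a != 0 -> has_lead (a *: (1 - Z)) U_(iz)%MM.
Proof.
move=> a0; have -> : a *: (1 - Z) = (- a) *: Z + a *: 1.
  by rewrite -!mul_mpolyC; ring.
apply: has_leadD.
  by apply: has_leadZ; [rewrite oppr_eq0 | apply: has_leadXU].
by rewrite -mul_mpolyC mulr1 mleadC gt0mU.
Qed.

Lemma has_lead_bary k :
  has_lead (bary R k) U_(nth ix [:: ix; ix; iy; iz] k)%MM.
Proof.
have a0 n : (n.+1%:R)^-1 != 0 :> R by rewrite invr_eq0 pnatr_eq0.
have tx : (mlead (8^-1 *: (1 - 2 *: Y - Z)) < U_(ix)%MM)%O.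
  by rewrite (has_lead_t (a0 7)).2 ltmU.
move: k; apply: ord4P; rewrite /bary (tnth_nth 0) /=.
- rewrite addrC -scaleNr; apply: has_leadD => //; apply: has_leadZ.
    by rewrite oppr_eq0.
  exact: has_leadXU.
- by rewrite addrC; apply: has_leadD => //; apply/has_leadZ/has_leadXU.
- have -> : 4^-1 *: (1 + 2 *: Y - Z) = 2^-1 *: Y + 4^-1 *: (1 - Z).
    have -> : (2^-1 : R) = 4^-1 * 2 by field.
    by rewrite -!mul_mpolyC; ring.
  by apply: has_leadD; [apply/has_leadZ/has_leadXU | apply: mlead_linear_lt].
- rewrite addrC; apply: has_leadZ => //; apply: has_leadD; first exact: has_leadXU.
  by rewrite mlead1 gt0mU.
Qed.

(** Each factor [t] that replaces a factor [s] lowers the leading monomial, so the term of the top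
    coefficient of [q] dominates. *)
Lemma has_lead_homogenize n (q : {poly R}) s t ms mt :
  (0 < n)%N -> size q = n.+1 -> has_lead s ms -> has_lead t mt -> (mt < ms)%O ->
  has_lead (homogenize n q s t) (ms *+ n)%MM.
Proof.
move=> n0 szq sP tP mts; rewrite /homogenize big_ord_recr /= subnn expr0 mulr1 addrC.
have q0 : q`_n != 0 by rewrite -[n]/(n.+1.-1) -szq -/(lead_coef q) lead_coef_eq0 -size_poly_eq0 szq.
apply: has_leadD; first exact/has_leadZ/has_leadX.
apply: mlead_sum_lt => [|i _].
  apply: lt_mdeg_ltmc; rewrite mdeg0 mdegMn muln_gt0 n0 andbT lt0n mdeg_eq0.
  by apply: contraTneq mts => ->; rewrite -leNgt le0x.
apply: le_lt_trans (mleadZ_le _ _) _.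
rewrite (has_leadM (has_leadX i sP) (has_leadX (n - i) tP)).2.
have -> : (ms *+ n = ms *+ i + ms *+ (n - i))%MM.
  by apply/mnmP => j; rewrite mnmDE !mulmnE -mulnDr subnKC // ltnW.
by rewrite ltmc_add2r; apply: ltmMn => //; rewrite subn_gt0.
Qed.

(** A root [c] of [q] becomes the factor [s - c *: t]: subtracting [q.[c] *: t ^+ n], which is zero,
    turns every term into a multiple of [s ^+ i - (c *: t) ^+ i]. *)
Lemma mdvd_homogenize l n (q : {poly R}) s t (c : R) :
  (size q <= n.+1)%N -> q.[c] = 0 -> mdvd l (s - c *: t) ->
  mdvd l (homogenize n q s t).
Proof.
move=> szq qc lst.
have -> : homogenize n q s t = \sum_(i < n.+1) q`_i *: ((s ^+ i - (c *: t) ^+ i) * t ^+ (n - i)).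
  have /(congr1 (fun a => a *: t ^+ n)) := horner_coef_wide c szq.
  rewrite qc scale0r scaler_suml => q0.
  rewrite -[LHS]subr0 [X in _ - X]q0 -sumrB.
  apply: eq_bigr => i _; rewrite mulrBl scalerBr exprZn -scalerAl scalerA.
  by rewrite -exprD subnKC // -ltnS.
apply: (big_ind (mdvd l)) => [|p1 p2|i _]; [exact: mdvd0 | exact: mdvdD|].
by apply/mdvdZ/mdvd_mulr; rewrite subrXX; apply: mdvd_mulr.
Qed.

Lemma mdvdZ_inv l p (c : R) : c != 0 -> mdvd l (c *: p) -> mdvd l p.
Proof. by move=> c0 /(mdvdZ c^-1); rewrite scalerA mulVf // scale1r. Qed.

(** The substitution [lq] is reduction modulo [l] with values in an integral domain: if [r] survives
    it, the product can only be killed through [p]. *)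
Lemma mdvd_coprime l r p (lq : 3.-tuple poly3) :
  (forall i, mdvd l ('X_i - tnth lq i)) -> l \mPo lq = 0 -> r \mPo lq != 0 ->
  mdvd l (p * r) -> mdvd l p.
Proof.
move=> lX l0 r0 [c /(congr1 (comp_mpoly lq))]; rewrite !rmorphM /= l0 mulr0.
move=> /eqP; rewrite mulf_eq0 (negPf r0) orbF => /eqP p0.
by rewrite -[p]subr0 -p0; apply: mdvd_comp.
Qed.

Lemma msize_comp_leq p (lq : 3.-tuple poly3) k :
  (forall i, msize (tnth lq i) <= 2)%N -> (msize p <= k)%N -> (msize (p \mPo lq) <= k)%N.
Proof.
move=> lq2 /msize_leP pk; rewrite comp_mpolyEX big_seq.
apply: msize_sum_leq => m /pk; apply: leq_trans; apply: msizeZ_leq.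
rewrite comp_mpolyX mdegE.
apply: (big_ind2 (fun p (a : nat) => (msize p <= a.+1)%N)) => [|p1 a p2 b pa pb|i _].
- by rewrite msize1.
- by rewrite -addSn; apply: msizeM_leq.
- exact: msizeX_leq.
Qed.

(** As z is the smallest variable, its power is the smallest monomial of degree [k]. *)
Lemma ltmUz m k : (m < (U_(iz) *+ k)%MM)%O -> (mdeg m < k)%N.
Proof.
move=> lt_m; have := lemc_mdeg (ltW lt_m); rewrite mdegMn mdeg1 mul1n.
rewrite leq_eqVlt => /predU1P[mk|//]; move: lt_m => /ltmcP.
rewrite mdegMn mdeg1 mul1n => /(_ mk) [i]; rewrite mulmnE mnm1E.
case: eqP => // <- lti; rewrite mul1n -{1}mk.
suff -> : mdeg m = m iz by rewrite ltnn.
by rewrite mdegE big_ord3 (lti ix) // (lti iy) // !mulmnE !mnm1E.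
Qed.

(** The substitution restricting a polynomial to the line through [vertex 2] and [vertex 3], the
    edge common to faces 0 and 1. *)
Definition edge_point : 3.-tuple poly3 := [tuple 0; 2^-1 *: (1 - Z); Z].

(** The terms other than the leading one have degree below [k], also after the substitution of
    affine forms, so they cannot cancel the power of z, which is left unchanged. *)
Lemma comp_edge_point_neq0 p k :
  has_lead p (U_(iz) *+ k)%MM -> p \mPo edge_point != 0.
Proof.
move=> [p0 pk]; set q := p - p@_(mlead p) *: 'X_[mlead p].
have szq : (msize q <= k)%N.
  have [->|q0] := eqVneq q 0; first by rewrite mmeasure0.
  by rewrite -mlead_deg //; apply/ltmUz; rewrite -pk; apply: ltm_mleadD.
have e2 i : (msize (tnth edge_point i) <= 2)%N.
  move: i; apply: ord3P; rewrite (tnth_nth 0) /=; first by rewrite mmeasure0.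
    by apply/msizeZ_leq/msizeB_leq; rewrite ?msize1 ?msizeX ?mdeg1.
  by rewrite msizeX mdeg1.
have := msize_mdeg_ge (leq_trans (msize_comp_leq e2 szq) _).
move=> /(_ (U_(iz) *+ k)%MM); rewrite mdegMn mdeg1 mul1n leqnn => /(_ isT).
move=> /memN_msupp_eq0 qz; apply/eqP => pz.
have : (p@_(mlead p) *: ('X_[mlead p] \mPo edge_point))@_(U_(iz) *+ k) = 0.
  have -> : p@_(mlead p) *: ('X_[mlead p] \mPo edge_point) =
      (p \mPo edge_point) - (q \mPo edge_point).
    by rewrite comp_mpolyB comp_mpolyZ opprB addrC subrK.
  by rewrite mcoeffB pz qz mcoeff0 subrr.
rewrite pk comp_mpolyX (bigD1 iz) //= big1 => [|i iz'].
  rewrite (tnth_nth 0) /= !mulmnE mnm1E eqxx mul1n mulr1 mcoeffZ mpolyXn mcoeffX eqxx mulr1.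
  by apply/eqP; rewrite -pk mleadc_eq0.
by rewrite mulmnE mnm1E eq_sym (negPf iz') mul0n expr0.
Qed.

End LeadingData.

(** * Exponent triples *)

Section Monomials.
Implicit Types (a b c : nat) (m : 'X_{1..3}).

Definition mnm3 a b c : 'X_{1..3} := [multinom nth 0%N [:: a; b; c] i | i < 3].

Lemma mnm3E a b c :
  ((mnm3 a b c ix = a) * (mnm3 a b c iy = b) * (mnm3 a b c iz = c))%type.
Proof. by rewrite !mnmE. Qed.

Lemma mnm3_inj a b c a' b' c' :
  mnm3 a b c = mnm3 a' b' c' -> [/\ a = a', b = b' & c = c'].
Proof.
move=> /mnmP e; move: (e ix) (e iy) (e iz).
by rewrite !mnm3E.
Qed.

Lemma mnm3K m : m = mnm3 (m ix) (m iy) (m iz).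
Proof. by apply/mnmP; apply: ord3P; rewrite mnm3E. Qed.

Lemma mdeg_mnm3 a b c : mdeg (mnm3 a b c) = (a + (b + c))%N.
Proof. by rewrite mdegE big_ord3 !mnm3E. Qed.

Lemma mnmU i a : (U_(i) *+ a)%MM =
  mnm3 ((i == ix) * a) ((i == iy) * a) ((i == iz) * a).
Proof. by apply/mnmP; apply: ord3P; rewrite mnm3E mulmnE mnm1E. Qed.

Lemma mnm3D a b c a' b' c' :
  (mnm3 a b c + mnm3 a' b' c')%MM = mnm3 (a + a') (b + b') (c + c').
Proof. by apply/mnmP; apply: ord3P; rewrite mnmDE !mnm3E. Qed.

Lemma mnm3B a b c a' b' c' :
  (mnm3 a b c - mnm3 a' b' c')%MM = mnm3 (a - a') (b - b') (c - c').
Proof. by apply/mnmP; apply: ord3P; rewrite mnmBE !mnm3E. Qed.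

Lemma mnmU1 i : U_(i)%MM = mnm3 (i == ix) (i == iy) (i == iz).
Proof. by rewrite -(mulm1n U_(i)) mnmU !muln1. Qed.

End Monomials.

(** * Auxiliary functions: leading monomials, faces where they vanish, derivatives *)

Section ShapeFunctions.
Variables (R : realType) (qx : nat -> {poly R}) (qy : nat -> nat -> {poly R}).
Variable qz : nat -> nat -> nat -> {poly R}.
Hypothesis qx_deg : forall i, (2 <= i)%N -> exact_degree i (qx i).
Hypothesis qx_root : forall i, (2 <= i)%N -> (qx i).[1] = 0 /\ (qx i).[-1] = 0.
Hypothesis qy_deg :
  forall i j, (1 <= i)%N -> (1 <= j)%N -> exact_degree j (qy i j).
Hypothesis qy_root :
  forall i j, (1 <= i)%N -> (1 <= j)%N -> (qy i j).[-1] = 0.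
Hypothesis qz_deg : forall i j k, (1 <= i)%N -> (1 <= j)%N -> (1 <= k)%N ->
  exact_degree k (qz i j k).
Hypothesis qz_root : forall i j k, (1 <= i)%N -> (1 <= j)%N -> (1 <= k)%N ->
  (qz i j k).[-1] = 0.

Local Notation poly3 := {mpoly R[3]}.
Local Notation field3 := {ffun 'I_3 -> poly3}.
Local Notation X := (X R).
Local Notation Y := (Y R).
Local Notation Z := (Z R).
Local Notation f := (aux_f qx).
Local Notation g := (aux_g qy).
Local Notation h := (aux_h qz).
Implicit Types (p q s : poly3) (v w : field3).

Lemma inv_nat_neq0 n : (n.+1%:R)^-1 != 0 :> R.
Proof. by rewrite invr_eq0 pnatr_eq0. Qed.

Lemma aux_h_homogenize i j k : (1 <= i)%N -> (1 <= j)%N -> (1 <= k)%N ->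
  h i j k = homogenize k (qz i j k) Z 1.
Proof.
move=> i1 j1 k1; rewrite /aux_h /homogenize (@horner_coef_wide _ k.+1).
  by apply: eq_bigr => m _; rewrite coef_map /= expr1n mulr1 mul_mpolyC.
by apply: leq_trans (size_poly _ _) _; rewrite qz_deg.
Qed.

Lemma has_lead_f i : (2 <= i)%N -> has_lead (f i) (mnm3 i 0 0).
Proof.
move=> i2; have -> : mnm3 i 0 0 = (U_(ix) *+ i)%MM by rewrite mnmU mul1n.
apply: has_lead_homogenize (has_leadXU _ _) (has_lead_t (inv_nat_neq0 3)) _.
- exact: ltnW.
- exact: qx_deg.
- exact: ltmU.
Qed.

Lemma has_lead_g i j : (1 <= i)%N -> (1 <= j)%N -> has_lead (g i j) (mnm3 0 j 0).
Proof.
move=> i1 j1; have -> : mnm3 0 j 0 = (U_(iy) *+ j)%MM by rewrite mnmU mul1n.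
apply: has_lead_homogenize (has_leadXU _ _) (has_lead_s (inv_nat_neq0 1)) _ => //.
- exact: qy_deg.
- exact: ltmU.
Qed.

Lemma has_lead_h i j k : (1 <= i)%N -> (1 <= j)%N -> (1 <= k)%N ->
  has_lead (h i j k) (mnm3 0 0 k).
Proof.
move=> i1 j1 k1; have -> : mnm3 0 0 k = (U_(iz) *+ k)%MM by rewrite mnmU mul1n.
rewrite aux_h_homogenize //.
apply: has_lead_homogenize (has_leadXU _ _) (has_lead1 R) _ => //.
- exact: qz_deg.
- exact: gt0mU.
Qed.

(** With [t] the second form in the homogenization, [X - t] and [X + t] are -2 and 2 times the
    coordinates of faces 0 and 1, so each of the two roots accounts for one face. *)
Lemma mdvd_f i (m : 'I_4) : (2 <= i)%N -> (m < 2)%N -> mdvd (bary R m) (f i).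
Proof.
move=> i2.
have [q1 qN1] := qx_root i2; have szq : (size (qx i) <= i.+1)%N by rewrite qx_deg.
have e : (4^-1 : R) = 2 * 8^-1 by field.
have e2 : X = (2 * 2^-1) *: X by rewrite mulfV ?pnatr_eq0 // scale1r.
move: m; apply: ord4P => // _; rewrite /bary (tnth_nth 0) /=.
- apply: (mdvd_homogenize szq q1); exists (- 2)%:MP.
  by rewrite e scale1r {1}e2 -!mul_mpolyC; ring.
- apply: (mdvd_homogenize szq qN1); exists (2%:MP).
  by rewrite e {1}e2 -!mul_mpolyC; ring.
Qed.

Lemma mdvd_g i j : (1 <= i)%N -> (1 <= j)%N -> mdvd (bary R face2) (g i j).
Proof.
move=> i1 j1; have szq : (size (qy i j) <= j.+1)%N by rewrite qy_deg.
apply: (mdvd_homogenize szq (qy_root i1 j1)); rewrite /bary (tnth_nth 0) /=.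
exists (2%:MP); have -> : (2^-1 : R) = 2 * 4^-1 by field.
have {1}-> : Y = (2 * 4^-1 * 2) *: Y.
  have -> : 2 * 4^-1 * 2 = 1 :> R by field.
  by rewrite scale1r.
by rewrite -!mul_mpolyC; ring.
Qed.

Lemma mdvd_h i j k : (1 <= i)%N -> (1 <= j)%N -> (1 <= k)%N ->
  mdvd (bary R face3) (h i j k).
Proof.
move=> i1 j1 k1; have szq : (size (qz i j k) <= k.+1)%N by rewrite qz_deg.
rewrite aux_h_homogenize //.
apply: (mdvd_homogenize szq (qz_root i1 j1 k1)); rewrite /bary (tnth_nth 0) /=.
exists (2%:MP); rewrite mul_mpolyC scalerA mulfV ?pnatr_eq0 //.
by rewrite scale1r scaleN1r opprK addrC.
Qed.

Lemma mderivX_eq0 d s k : mderiv d s = 0 -> mderiv d (s ^+ k) = 0.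
Proof.
move=> s0; elim: k => [|k IH]; first by rewrite expr0 -mpolyC1 mderivC.
by rewrite exprS mderivM s0 IH mul0r mulr0 addr0.
Qed.

Lemma mderiv_homogenize d n (q : {poly R}) s t :
  mderiv d s = 0 -> mderiv d t = 0 -> mderiv d (homogenize n q s t) = 0.
Proof.
move=> s0 t0; rewrite raddf_sum big1 // => i _ /=.
by rewrite mderivZ mderivM !mderivX_eq0 // mul0r mulr0 addr0 scaler0.
Qed.

(** [g] involves only y and z, and [h] only z: this is the source of the triangular shape of the
    component matrix. *)
Lemma mderiv_g i j : mderiv ix (g i j) = 0.
Proof.
apply: mderiv_homogenize; rewrite ?mderivZ ?mderivB -?mpolyC1 ?mderivC !mderivXU //=.
by rewrite mpolyC0 subrr scaler0.
Qed.

Lemma mderiv_h (d : 'I_3) i j k : (1 <= i)%N -> (1 <= j)%N -> (1 <= k)%N -> (d < 2)%N ->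
  mderiv d (h i j k) = 0.
Proof.
move=> i1 j1 k1; rewrite aux_h_homogenize // => d2; apply: mderiv_homogenize.
  by rewrite mderivXU; move: d d2; apply: ord3P.
by rewrite -mpolyC1 mderivC.
Qed.

(** * Fields with the gradient of a single factor: traces, degrees, leading monomials *)

Definition fieldX i j k := pmul (g i j * h i j k) (grad (f i)).
Definition fieldY i j k := pmul (f i * h i j k) (grad (g i j)).
Definition fieldZ i j k := pmul (f i * g i j) (grad (h i j k)).

Lemma fun_IE i j k : fun_I qx qy qz i j k = fieldX i j k + fieldY i j k + fieldZ i j k.
Proof.
by apply/ffunP => d; rewrite !fieldDE !pmulE !gradE !mderivM; ring.
Qed.

Lemma fun_IIE i j k :
  fun_II qx qy qz i j k = j%:R *: fieldX i j k - i%:R *: fieldY i j k.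
Proof. by []. Qed.

Lemma fun_IIIE i j k :
  fun_III qx qy qz i j k = k%:R *: fieldX i j k - i%:R *: fieldZ i j k.
Proof. by []. Qed.

(* The edge function is the Whitney form of the edge. *)
Lemma edge_fun12E :
  edge_fun12 R =
  pmul (bary R face1) (grad (bary R face0)) - pmul (bary R face0) (grad (bary R face1)).
Proof.
have e8 : (8^-1 : R) = 4^-1 * 2^-1 by field.
have e4 : (4^-1 : R) = 2^-1 * 2^-1 by field.
have X2 q : q = (2^-1 * 2) *: q by rewrite mulVf ?pnatr_eq0 // scale1r.
apply/ffunP; apply: ord3P; rewrite fieldZE fieldBE !pmulE !grad_baryE !vec3E div1r;
  rewrite /bary !(tnth_nth 0) /= e8 e4.
- by rewrite [LHS]X2 -!mul_mpolyC; ring.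
- by rewrite -!mul_mpolyC; ring.
- by rewrite [LHS]X2 -!mul_mpolyC; ring.
Qed.

Lemma bary_mdvd_mult i j k m : (2 <= i)%N -> (1 <= j)%N -> (1 <= k)%N ->
  [\/ mdvd (bary R m) (f i), mdvd (bary R m) (g i j) | mdvd (bary R m) (h i j k)].
Proof.
move=> i2 j1 k1; have i1 := ltnW i2.
case: (ltnP m 2) => face2; first by apply: Or31; apply: mdvd_f.
move: m face2; apply: ord4P => // _.
  by apply: Or32; apply: mdvd_g.
by apply: Or33; apply: mdvd_h.
Qed.

(** Modulo [l], either the gradient is parallel to [grad l] or the scalar factor vanishes. *)
Lemma tangential_pmul_grad l p q s :
  [\/ mdvd l p, mdvd l q | mdvd l s] -> tangential l (pmul (q * s) (grad p)).
Proof.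
case=> d; first exact/tangential_pmul/tangential_grad.
  exact/tangential_pmul_mdvd/mdvd_mulr.
exact/tangential_pmul_mdvd/mdvd_mull.
Qed.

(** Here [k] bounds [msize], hence is one more than the degree, whereas the index of [nedelec2] is
    the degree. *)
Definition trace_free k v :=
  (forall m, tangential (bary R m) v) /\ forall d, (msize (v d) <= k)%N.

Lemma interior_nedelec2P k v : interior (@nedelec2 R k) v <-> trace_free k.+1 v.
Proof. by rewrite /interior zero_tangential_traceP; split=> -[]. Qed.

Lemma trace_freeB k v w : trace_free k v -> trace_free k w -> trace_free k (v - w).
Proof.
move=> [tv sv] [tw sw]; split=> [m|d]; first exact: tangentialB.
by rewrite fieldBE; apply: msizeB_leq.
Qed.

Lemma trace_freeZ k a v : trace_free k v -> trace_free k (a *: v).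
Proof.
move=> [tv sv]; split=> [m|d]; first exact: tangentialZ.
by rewrite fieldZE; apply: msizeZ_leq.
Qed.

Lemma trace_freeD k v w : trace_free k v -> trace_free k w -> trace_free k (v + w).
Proof.
move=> [tv sv] [tw sw]; split=> [m|d]; first exact: tangentialD.
by rewrite fieldDE; apply: msizeD_leq.
Qed.

Lemma msize_pmul_grad p q s a b c :
  msize p = a.+1 -> msize q = b.+1 -> msize s = c.+1 ->
  forall d, (msize (pmul (q * s) (grad p) d) <= a + b + c)%N.
Proof.
move=> pa qb sc d; rewrite pmulE gradE mulrC mulrA.
by apply: msizeM_leq; rewrite ?sc //; apply: msizeM_leq; rewrite ?qb // msize_mderiv_leq ?pa.
Qed.

Section Indices.
Variables i j k : nat.
Hypotheses (i2 : (2 <= i)%N) (j1 : (1 <= j)%N) (k1 : (1 <= k)%N).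
Let i1 : (1 <= i)%N := ltnW i2.

Lemma msize_f : msize (f i) = i.+1.
Proof. by rewrite (has_lead_msize (has_lead_f i2)) mdeg_mnm3 ?addn0. Qed.

Lemma msize_g : msize (g i j) = j.+1.
Proof. by rewrite (has_lead_msize (has_lead_g i1 j1)) mdeg_mnm3 ?addn0. Qed.

Lemma msize_h : msize (h i j k) = k.+1.
Proof. by rewrite (has_lead_msize (has_lead_h i1 j1 k1)) mdeg_mnm3 ?addn0. Qed.

Lemma fieldX_trace_free n : (i + j + k <= n)%N -> trace_free n (fieldX i j k).
Proof.
move=> le_n; split=> [m|d]; first exact/tangential_pmul_grad/bary_mdvd_mult.
exact: leq_trans (msize_pmul_grad msize_f msize_g msize_h d) le_n.
Qed.

Lemma fieldY_trace_free n : (i + j + k <= n)%N -> trace_free n (fieldY i j k).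
Proof.
move=> le_n; split=> [m|d].
  apply: tangential_pmul_grad.
  by case: (bary_mdvd_mult m i2 j1 k1) => H; [apply: Or32 | apply: Or31 | apply: Or33].
by apply: leq_trans (msize_pmul_grad msize_g msize_f msize_h d) _; lia.
Qed.

Lemma fieldZ_trace_free n : (i + j + k <= n)%N -> trace_free n (fieldZ i j k).
Proof.
move=> le_n; split=> [m|d].
  apply: tangential_pmul_grad.
  by case: (bary_mdvd_mult m i2 j1 k1) => H; [apply: Or32 | apply: Or33 | apply: Or31].
by apply: leq_trans (msize_pmul_grad msize_h msize_f msize_g d) _; lia.
Qed.

Lemma has_lead_fieldX : has_lead (fieldX i j k ix) (mnm3 i.-1 j k).
Proof.
rewrite /fieldX pmulE gradE.
have -> : mnm3 i.-1 j k = (mnm3 0 j 0 + mnm3 0 0 k + (mnm3 i 0 0 - U_(ix)))%MM.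
  by rewrite mnmU1 mnm3B !mnm3D /= subn1 !addn0.
apply: has_leadM; first by apply: has_leadM; [apply: has_lead_g | apply: has_lead_h].
by apply: has_lead_mderiv; [apply: has_lead_f | rewrite mnm3E].
Qed.

Lemma has_lead_fieldY : has_lead (fieldY i j k iy) (mnm3 i j.-1 k).
Proof.
rewrite /fieldY pmulE gradE.
have -> : mnm3 i j.-1 k = (mnm3 i 0 0 + mnm3 0 0 k + (mnm3 0 j 0 - U_(iy)))%MM.
  by rewrite mnmU1 mnm3B !mnm3D /= subn1 !addn0.
apply: has_leadM; first by apply: has_leadM; [apply: has_lead_f | apply: has_lead_h].
by apply: has_lead_mderiv; [apply: has_lead_g | rewrite mnm3E].
Qed.

Lemma has_lead_fieldZ : has_lead (fieldZ i j k iz) (mnm3 i j k.-1).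
Proof.
rewrite /fieldZ pmulE gradE.
have -> : mnm3 i j k.-1 = (mnm3 i 0 0 + mnm3 0 j 0 + (mnm3 0 0 k - U_(iz)))%MM.
  by rewrite mnmU1 mnm3B !mnm3D /= subn1 !addn0.
apply: has_leadM; first by apply: has_leadM; [apply: has_lead_f | apply: has_lead_g].
by apply: has_lead_mderiv; [apply: has_lead_h | rewrite mnm3E].
Qed.

Lemma has_lead_potential : has_lead (f i * g i j * h i j k) (mnm3 i j k).
Proof.
have -> : mnm3 i j k = (mnm3 i 0 0 + mnm3 0 j 0 + mnm3 0 0 k)%MM.
  by rewrite !mnm3D !addn0.
apply: has_leadM; last exact: has_lead_h.
by apply: has_leadM; [apply: has_lead_f | apply: has_lead_g].
Qed.

Lemma fieldY_ix : fieldY i j k ix = 0.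
Proof. by rewrite /fieldY pmulE gradE mderiv_g mulr0. Qed.

Lemma fieldZ_ix : fieldZ i j k ix = 0.
Proof. by rewrite /fieldZ pmulE gradE mderiv_h ?mulr0. Qed.

Lemma fieldZ_iy : fieldZ i j k iy = 0.
Proof. by rewrite /fieldZ pmulE gradE mderiv_h ?mulr0. Qed.

End Indices.

Lemma msize_edge_fun12 d : (msize (edge_fun12 R d) <= 2)%N.
Proof.
have X2 (e : 'I_3) : (msize ('X_e : poly3) <= 2)%N by rewrite msizeX mdeg1.
rewrite /edge_fun12 fieldZE; apply: msizeZ_leq; move: d.
apply: ord3P; rewrite vec3E; [|exact/msizeZ_leq/X2|exact: X2].
apply: msizeB_leq; last exact: X2.
by apply: msizeB_leq; [rewrite msize1 | apply/msizeZ_leq/X2].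
Qed.

Section EdgeIndices.
Variables j k : nat.
Hypotheses (j1 : (1 <= j)%N) (k1 : (1 <= k)%N).

Lemma has_lead_fun_IV : has_lead (fun_IV qy qz j k ix) (mnm3 0 j.+1 k).
Proof.
rewrite /fun_IV pmulE fieldZE vec3E.
have -> : mnm3 0 j.+1 k = (mnm3 0 j 0 + mnm3 0 0 k + U_(iy))%MM.
  by rewrite mnmU1 !mnm3D /= !addn0 addn1.
apply: has_leadM; first by apply: has_leadM; [apply: has_lead_g | apply: has_lead_h].
by apply: has_lead_t; rewrite oppr_eq0 div1r inv_nat_neq0.
Qed.

Lemma fun_IV_trace_free n : (j + k + 2 <= n)%N -> trace_free n (fun_IV qy qz j k).
Proof.
move=> le_n; split=> [m|d]; last first.
  apply: leq_trans le_n; have -> : (j + k + 2 = (j.+1 + k) + 1)%N by lia.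
  rewrite /fun_IV pmulE; apply: msizeM_leq; last exact: msize_edge_fun12.
  apply: msizeM_leq; first by rewrite (has_lead_msize (@has_lead_g 1 j _ j1)) // mdeg_mnm3; lia.
  by rewrite (has_lead_msize (@has_lead_h 1 j k _ j1 k1)) // mdeg_mnm3; lia.
have refl l : mdvd l l by exists 1; rewrite mul1r.
(* On faces 0 and 1 one term of the Whitney form has a normal gradient and the other a vanishing
   factor; on faces 2 and 3 the scalar factors [g] and [h] vanish. *)
move: m; apply: ord4P.
- apply: tangential_pmul; rewrite edge_fun12E; apply: tangentialB.
    exact/tangential_pmul/tangential_grad.
  exact/tangential_pmul_mdvd.
- apply: tangential_pmul; rewrite edge_fun12E; apply: tangentialB.
    exact/tangential_pmul_mdvd.
  exact/tangential_pmul/tangential_grad.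
- by apply: tangential_pmul_mdvd; apply: mdvd_mulr; apply: mdvd_g.
- by apply: tangential_pmul_mdvd; apply: mdvd_mull; apply: mdvd_h.
Qed.

End EdgeIndices.


(** * Spanning by reduction of leading terms *)

Lemma lead_reduction (U W : field3 -> Prop) (d : 'I_3) :
    (forall v w (a : R), U v -> U w -> U (v - a *: w)) ->
    W 0 -> (forall v w (a : R), W v -> W w -> W (v + a *: w)) ->
    (forall v, U v -> v d != 0 ->
       exists w, [/\ W w, U w & has_lead (w d) (mlead (v d))]) ->
  forall v, U v -> exists w, [/\ W w, U (v - w) & (v - w) d = 0].
Proof.
move=> UB W0 WD step v; move def_p: (v d) => p.
(* As in polynomial division, a multiple of [w] cancels the leading term of the component [d]. The
   property [U] is kept by the remainder, while [W] collects what is subtracted. *)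
elim/mleadrect: p v def_p => p IH v def_p Uv.
have [p0|p0] := eqVneq p 0; first by exists 0; rewrite subr0 def_p.
have [|w [Ww Uw [wd0 wd]]] := step v Uv; first by rewrite def_p.
pose a := p@_(mlead p) / (w d)@_(mlead (w d)).
have wd' : mlead (w d) = mlead p by rewrite wd def_p.
have ap : (p - a *: w d)@_(mlead p) = 0.
  by rewrite mcoeffB mcoeffZ -{2}wd' /a divfK ?subrr // mleadc_eq0.
have Uv' := UB v w a Uv Uw.
have vd' : (v - a *: w) d = p - a *: w d by rewrite fieldBE fieldZE def_p.
have [pa0|pa0] := eqVneq (p - a *: w d) 0.
  exists (a *: w); split=> //; last by rewrite vd' pa0.
  by rewrite -[a *: w]add0r; apply: WD.
have lt_p : (mlead (p - a *: w d) < mlead p)%O.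
  rewrite lt_neqAle; apply/andP; split.
    by apply: contraNneq pa0 => e; rewrite -mleadc_eq0 e ap.
  apply: le_trans (mleadB_le _ _) _; rewrite leUx lexx /=.
  by rewrite -wd'; apply: mleadZ_le.
have [w' [Ww' Uw' w'd]] := IH _ lt_p _ vd' Uv'.
exists (w' + a *: w).
have -> : v - (w' + a *: w) = v - a *: w - w' by rewrite opprD addrA addrAC.
by split=> //; apply: WD.
Qed.

(** The gradient of this coordinate is parallel to the z axis, so the trace on face 3 consists of
    the x and y components. *)
Lemma trace_face3 v : tangential (bary R face3) v ->
  mdvd (bary R face3) (v ix) /\ mdvd (bary R face3) (v iy).
Proof.
move=> tv; move: (tv ix) (tv iy).
rewrite !crossE grad_baryE !vec3E /= mpolyC0 !mul0r subr0 sub0r !mul_mpolyC -scaleNr.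
move=> dy dx; split; [move: dx | move: dy]; apply: mdvdZ_inv.
  exact: inv_nat_neq0.
by rewrite oppr_eq0 inv_nat_neq0.
Qed.

Lemma trace_face2_ix v : tangential (bary R face2) v -> mdvd (bary R face2) (v ix).
Proof.
move=> /(_ iz); rewrite !crossE grad_baryE !vec3E /= mpolyC0 !mul0r sub0r !mul_mpolyC.
by rewrite -scaleNr; apply: mdvdZ_inv; rewrite oppr_eq0 inv_nat_neq0.
Qed.

Lemma trace_face2_iz v : tangential (bary R face2) v -> v iy = 0 -> mdvd (bary R face2) (v iz).
Proof.
move=> + vy; move=> /(_ ix); rewrite !crossE grad_baryE !vec3E /= vy mulr0 subr0 mul_mpolyC.
exact/mdvdZ_inv/inv_nat_neq0.
Qed.

Lemma trace_x0 v (m : 'I_4) : (m < 2)%N -> tangential (bary R m) v -> v ix = 0 ->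
  mdvd (bary R m) (v iy) /\ mdvd (bary R m) (v iz).
Proof.
move=> face2 tv vx; move: (tv iy) (tv iz).
rewrite !crossE grad_baryE !vec3E vx !mulr0 sub0r subr0 !mul_mpolyC -scaleNr.
have a0 : nth 0 [:: - 2^-1; 2^-1; 0; 0] m != 0 :> R.
  by move: m face2 {tv}; apply: ord4P => //= _; rewrite ?oppr_eq0 inv_nat_neq0.
by move=> dz dy; split; [move: dy | move: dz]; apply: mdvdZ_inv; rewrite ?oppr_eq0.
Qed.

(** On the edge common to both faces the field is parallel to two independent normals, hence zero.
    The sum of the z components of the two cross products isolates [v ix]. *)
Lemma comp_edge_point_ix v :
  tangential (bary R face0) v -> tangential (bary R face1) v ->
  v ix \mPo edge_point R = 0.
Proof.
have edge0 (m : 'I_4) : (m < 2)%N -> bary R m \mPo edge_point R = 0.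
  have e2 : (2 * 2^-1 : R) = 1 by rewrite mulfV ?pnatr_eq0.
  move: m; apply: ord4P => // _; rewrite /bary (tnth_nth 0) /=;
    rewrite ?(comp_mpolyD, comp_mpolyB, comp_mpolyN, comp_mpolyZ, comp_mpoly1, comp_mpolyXU) /=;
    rewrite scalerA e2 scale1r opprB addrCA subrr addr0 subrr !scaler0;
    by rewrite ?addr0 ?subr0.
have trace_edge (m : 'I_4) : (m < 2)%N -> tangential (bary R m) v ->
    nth 0 [:: - 2^-1; 2^-1; 0; 0] m *: (v iy \mPo edge_point R) +
    4^-1 *: (v ix \mPo edge_point R) = 0.
  move=> face2 /(_ iz) [c]; rewrite crossE grad_baryE !vec3E !mul_mpolyC.
  have -> : nth 0 [:: - 4^-1; - 4^-1; 2^-1; 0] m = - 4^-1 :> R.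
    by move: m face2; apply: ord4P.
  rewrite scaleNr opprK -!comp_mpolyZ -comp_mpolyD => ->.
  by rewrite rmorphM /= edge0 // mulr0.
move=> /(trace_edge face0 isT) /= e0 /(trace_edge face1 isT) /= e1; move: e0 e1.
move: (v ix \mPo _) (v iy \mPo _) => x y e0 e1.
have -> : x = 2 *: ((- 2^-1 *: y + 4^-1 *: x) + (2^-1 *: y + 4^-1 *: x)).
  rewrite scaleNr addrACA addNr add0r -scalerDl scalerA.
  have -> : 2 * (4^-1 + 4^-1) = 1 :> R by field.
  by rewrite scale1r.
by rewrite e0 e1 addr0 scaler0.
Qed.

Lemma comp_edge_point_face2 : bary R face2 \mPo edge_point R != 0.
Proof.
have -> : bary R face2 \mPo edge_point R = 2^-1 *: (1 - Z).
  rewrite /bary (tnth_nth 0) /= comp_mpolyZ comp_mpolyB comp_mpolyD comp_mpolyZ.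
  rewrite comp_mpoly1 !comp_mpolyXU /= scalerA mulfV ?pnatr_eq0 // scale1r.
  have -> : 2^-1 = 2 * 4^-1 :> R by field.
  by rewrite -!mul_mpolyC; ring.
by case: (has_lead_s (inv_nat_neq0 1)).
Qed.

Lemma mdvd_bary_mlead p (m : 'I_4) : p != 0 -> mdvd (bary R m) p ->
  (0 < mlead p (nth ix [:: ix; ix; iy; iz] m))%N.
Proof.
move=> p0 /(mdvd_mlead p0); rewrite (has_lead_bary R m).2 => /mnm_lepP.
by move=> /(_ (nth ix [:: ix; ix; iy; iz] m)); rewrite mnm1E eqxx.
Qed.

(** The two coordinates are coprime, so [p] is a multiple of their product, whose leading monomial
    is the square of x. *)
Lemma mdvd_bary01_mlead p : p != 0 -> mdvd (bary R face0) p -> mdvd (bary R face1) p ->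
  (1 < mlead p ix)%N.
Proof.
(* Reduction modulo [bary face0]: x is replaced by a quarter of [1 - 2y - z]. *)
move=> p0 b0p [c pE]; pose lq : 3.-tuple poly3 := [tuple X + 2 *: bary R face0; Y; Z].
have c0 : c != 0 by apply: contraNneq p0 => c0; rewrite pE c0 mul0r.
have b0c : mdvd (bary R face0) c.
  have bE (m : 'I_4) : (m < 2)%N -> bary R m \mPo lq =
      8^-1 *: (1 - 2 *: Y - Z) + nth 0 [:: - 2^-1; 2^-1] m *: (X + 2 *: bary R face0).
    move: m; apply: ord4P => // _; rewrite {1}/bary (tnth_nth 0) /= -?scaleNr;
    by rewrite ?(comp_mpolyD, comp_mpolyB, comp_mpolyN, comp_mpolyZ, comp_mpoly1, comp_mpolyXU).
  have e2 : 2 * 2^-1 = 1 :> R by rewrite mulfV ?pnatr_eq0.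
  apply: (@mdvd_coprime _ _ (bary R face1) _ lq); last by rewrite -pE.
  - apply: ord3P; rewrite (tnth_nth 0) /=; [|by rewrite subrr; apply: mdvd0..].
    exists (- 2)%:MP; rewrite mul_mpolyC scaleNr opprD addrA subrr add0r.
    by [].
  - rewrite bE //= [_ *: (X + _)]scalerDr scalerA mulNr mulVf ?pnatr_eq0 // scaleN1r.
    rewrite /bary (tnth_nth 0) /= scaleNr; ring.
  - rewrite bE //= [_ *: (X + _)]scalerDr scalerA mulVf ?pnatr_eq0 // scale1r.
    have -> : 8^-1 *: (1 - 2 *: Y - Z) + (2^-1 *: X + bary R face0) = 4^-1 *: (1 - 2 *: Y - Z).
      rewrite /bary (tnth_nth 0) /= [X in _ + X]addrC subrK -scalerDl.
      by congr (_ *: _); field.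
    by case: (has_lead_t (inv_nat_neq0 3)).
have c_ix := mdvd_bary_mlead c0 b0c; move: c_ix => /= c_ix.
have [b10 b1E] := has_lead_bary R face1.
by rewrite pE mleadM // b1E mnmDE mnm1E /= addn1.
Qed.

(** The components are reduced to zero in the order x, y, z. The later fields do not disturb the
    earlier components, as [fieldY] has no x component and [fieldZ] neither an x nor a y
    component. *)
Lemma trace_free_ind n (W : field3 -> Prop) :
    W 0 -> (forall v w (a : R), W v -> W w -> W (v + a *: w)) ->
    (forall i j k, (2 <= i)%N -> (1 <= j)%N -> (1 <= k)%N -> (i + j + k <= n)%N ->
       [/\ W (fieldX i j k), W (fieldY i j k) & W (fieldZ i j k)]) ->
    (forall j k, (1 <= j)%N -> (1 <= k)%N -> (j + k + 2 <= n)%N ->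
       W (fun_IV qy qz j k)) ->
  forall v, trace_free n v -> W v.
Proof.
move=> W0 WD WXYZ WIV v Uv.
have UB v1 v2 (a : R) : trace_free n v1 -> trace_free n v2 -> trace_free n (v1 - a *: v2).
  by move=> U1 U2; apply/trace_freeB/trace_freeZ.
have degP (u : field3) d : trace_free n u -> u d != 0 ->
    (mlead (u d) ix + (mlead (u d) iy + mlead (u d) iz) < n)%N.
  by move=> [_ /(_ d) un] ud; rewrite -mdeg_mnm3 -mnm3K mlead_deg.
have [|vx [Wx Ux vx0]] := lead_reduction (d := ix) UB W0 WD _ Uv.
  move=> u Uu ux; have [Tu _] := Uu; have [b3x _] := trace_face3 (Tu face3).
  have b2x := trace_face2_ix (Tu face2).
  have := degP u ix Uu ux; have := mdvd_bary_mlead ux b2x; have := mdvd_bary_mlead ux b3x.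
  have := mnm3K (mlead (u ix)); set a := mlead _ ix; set b := mlead _ iy; set c := mlead _ iz.
  move=> /= mE c0 b0 abc; case: (posnP a) => [a0|a0]; last first.
    have abc' : (a.+1 + b + c <= n)%N by lia.
    exists (fieldX a.+1 b c); rewrite mE; split.
    - by have [] := WXYZ a.+1 b c a0 b0 c0 abc'.
    - exact: fieldX_trace_free.
    - exact: (@has_lead_fieldX a.+1).
  (* If y had exponent 1, the quotient [q] of [u ix] by the coordinate of face 2 would have a power
     of z as leading monomial and so not vanish on the edge. But [u ix] vanishes there, while that
     coordinate does not vanish identically. *)
  have b1 : (1 < b)%N.
    rewrite ltn_neqAle b0 andbT; apply/eqP => b1; case: b2x => q qE.
    have q0 : q != 0 by apply: contraNneq ux => q0; rewrite qE q0 mul0r.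
    have [b20 b2E] := has_lead_bary R face2.
    have : q \mPo edge_point R != 0.
      apply: (@comp_edge_point_neq0 _ _ c); split=> //.
      have : mlead (u ix) = (mlead q + U_(iy))%MM by rewrite qE mleadM // b2E.
      rewrite mE a0 -b1 => /mnmP e.
      apply/mnmP; apply: ord3P; have := e ix; have := e iy; have := e iz;
        by rewrite !mnmDE !mnm3E mulmnE !mnm1E /= ?mul0n ?mul1n !addn0 addn1 => ez [ey] ex.
    have := comp_edge_point_ix (Tu face0) (Tu face1).
    rewrite qE rmorphM => /eqP /=; rewrite mulf_eq0 (negPf comp_edge_point_face2) orbF.
    by move=> ->.
  have b1' : (0 < b.-1)%N by lia.
  have bc : (b.-1 + c + 2 <= n)%N by lia.
  exists (fun_IV qy qz b.-1 c); rewrite mE a0; split.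
  - exact: WIV.
  - exact: fun_IV_trace_free.
  - by rewrite -{2}[b]prednK //; apply: has_lead_fun_IV.
pose Uy u := trace_free n u /\ u ix = 0.
have UyB v1 v2 (a : R) : Uy v1 -> Uy v2 -> Uy (v1 - a *: v2).
  move=> [U1 x1] [U2 x2]; split; first exact: UB.
  by rewrite fieldBE fieldZE x1 x2 scaler0 subrr.
have [|vy [Wy [Uvy vyx0] vy0]] := lead_reduction (d := iy) UyB W0 WD _ (conj Ux vx0).
  move=> u [Uu ux] uy; have [Tu _] := Uu; have [_ b3y] := trace_face3 (Tu face3).
  have [b0y _] := trace_x0 (isT : (face0 < 2)%N) (Tu face0) ux.
  have [b1y _] := trace_x0 (isT : (face1 < 2)%N) (Tu face1) ux.
  have := degP u iy Uu uy; have := mdvd_bary01_mlead uy b0y b1y.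
  have := mdvd_bary_mlead uy b3y.
  have := mnm3K (mlead (u iy)); set a := mlead _ ix; set b := mlead _ iy; set c := mlead _ iz.
  move=> /= mE c0 a0 abc; have abc' : (a + b.+1 + c <= n)%N by lia.
  exists (fieldY a b.+1 c); rewrite mE; split.
  - by have [] := WXYZ a b.+1 c a0 isT c0 abc'.
  - by split; [apply: fieldY_trace_free | apply: fieldY_ix].
  - exact: (@has_lead_fieldY a b.+1).
pose Uz u := Uy u /\ u iy = 0.
have UzB v1 v2 (a : R) : Uz v1 -> Uz v2 -> Uz (v1 - a *: v2).
  move=> [U1 y1] [U2 y2]; split; first exact: UyB.
  by rewrite fieldBE fieldZE y1 y2 scaler0 subrr.
have [|vz [Wz [[Uvz vzx0] vzy0] vz0]] :=
    lead_reduction (d := iz) UzB W0 WD _ (conj (conj Uvy vyx0) vy0).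
  move=> u [[Uu ux] uy] uz; have [Tu _] := Uu; have b2z := trace_face2_iz (Tu face2) uy.
  have [_ b0z] := trace_x0 (isT : (face0 < 2)%N) (Tu face0) ux.
  have [_ b1z] := trace_x0 (isT : (face1 < 2)%N) (Tu face1) ux.
  have := degP u iz Uu uz; have := mdvd_bary01_mlead uz b0z b1z.
  have := mdvd_bary_mlead uz b2z.
  have := mnm3K (mlead (u iz)); set a := mlead _ ix; set b := mlead _ iy; set c := mlead _ iz.
  move=> /= mE b0 a0 abc; have abc' : (a + b + c.+1 <= n)%N by lia.
  exists (fieldZ a b c.+1); rewrite mE; split.
  - by have [] := WXYZ a b c.+1 a0 b0 isT abc'.
  - split; last exact: fieldZ_iy.
    by split; [apply: fieldZ_trace_free | apply: fieldZ_ix].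
  - exact: (@has_lead_fieldZ a b c.+1).
have -> : v = (vx + 1 *: vy) + 1 *: vz.
  apply/eqP; rewrite !scale1r -subr_eq0 !opprD !addrA; apply/eqP/ffunP.
  by apply: ord3P; rewrite [RHS]ffunE.
by apply: (WD) => //; apply: (WD).
Qed.

(** * Linear independence of the single-gradient fields and type IV *)

Local Notation T3 := (nat * nat * nat)%type.
Local Notation T2 := (nat * nat)%type.

Definition wf3 (t : T3) := [&& 1 < t.1.1, 0 < t.1.2 & 0 < t.2]%N.
Definition wf2 (t : T2) := (0 < t.1)%N && (0 < t.2)%N.

Lemma triple_inj (t u : T3) : t.1.1 = u.1.1 -> t.1.2 = u.1.2 -> t.2 = u.2 -> t = u.
Proof. by case: t u => [[? ?] ?] [[? ?] ?] /= -> -> ->. Qed.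

(** The x component involves only [fieldX] and [fun_IV], and among their leading monomials only the
    former contain x. Once these coefficients vanish, the y component isolates [fieldY], and then
    the z component isolates [fieldZ]. *)
Lemma fields_free (e : seq T3) (e2 : seq T2) (a b c : T3 -> R) (d : T2 -> R) :
    uniq e -> uniq e2 -> {in e, forall t, wf3 t} -> {in e2, forall t, wf2 t} ->
    \sum_(t <- e) (a t *: fieldX t.1.1 t.1.2 t.2 + b t *: fieldY t.1.1 t.1.2 t.2
                   + c t *: fieldZ t.1.1 t.1.2 t.2)
    + \sum_(t <- e2) d t *: fun_IV qy qz t.1 t.2 = 0 ->
  {in e, forall t, [/\ a t = 0, b t = 0 & c t = 0]} /\ {in e2, forall t, d t = 0}.
Proof.
move=> ue ue2 we we2 sum0.
pose S := \sum_(t <- e) (a t *: fieldX t.1.1 t.1.2 t.2 + b t *: fieldY t.1.1 t.1.2 t.2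
                   + c t *: fieldZ t.1.1 t.1.2 t.2).
have SE o : S o = \sum_(t <- e) (a t *: fieldX t.1.1 t.1.2 t.2 o
    + b t *: fieldY t.1.1 t.1.2 t.2 o + c t *: fieldZ t.1.1 t.1.2 t.2 o).
  by rewrite sum_ffunE; apply: eq_bigr => t _; rewrite !fieldDE !fieldZE.
have /ffunP sum0' := sum0.
pose G (x : T3 + T2) := match x with
  | inl t => fieldX t.1.1 t.1.2 t.2 ix | inr t => fun_IV qy qz t.1 t.2 ix end.
pose C (x : T3 + T2) := match x with inl t => a t | inr t => d t end.
pose M (x : T3 + T2) := match x with
  | inl t => mnm3 t.1.1.-1 t.1.2 t.2 | inr t => mnm3 0 t.1.+1 t.2 end.
pose E : seq (T3 + T2) := map inl e ++ map inr e2.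
have uE : uniq E.
  rewrite cat_uniq !map_inj_uniq ?ue ?ue2 //= => [|? ? []|? ? []] //.
  by rewrite andbT; apply/hasPn => x /mapP[t _ ->]; apply/mapP => -[].
have leadE : {in E, forall x, has_lead (G x) (M x)}.
  move=> x; rewrite mem_cat => /orP[] /mapP[t te ->] /=.
    by have /and3P[? ? ?] := we t te; apply: has_lead_fieldX.
  by have /andP[? ?] := we2 t te; apply: has_lead_fun_IV.
have injM : {in E &, injective M}.
  move=> x y; rewrite !mem_cat => /orP[] /mapP[t te ->] /orP[] /mapP[u ue' ->] /= /mnm3_inj[].
  - have /and3P[t1 _ _] := we t te; have /and3P[u1 _ _] := we u ue' => e1 e2' e3.
    by congr inl; apply: triple_inj => //; lia.
  - by have /and3P[t1 _ _] := we t te => ?; lia.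
  - by have /and3P[t1 _ _] := we u ue' => ?; lia.
  - by move=> _ [e1] e3; congr inr; case: t u e1 e3 {te ue'} => [? ?] [? ?] /= -> ->.
have CE : {in E, forall x, C x = 0}.
  apply: (@free_mlead _ _ _ E G C 0) => //.
  - by move=> x /leadE[].
  - move=> x y xE yE /=; rewrite (leadE x xE).2 (leadE y yE).2; exact: injM.
  have := sum0' ix; rewrite fieldDE SE [RHS]ffunE => sum0x.
  rewrite big_cat !big_map /=.
  suff -> : \sum_(t <- e) a t *: fieldX t.1.1 t.1.2 t.2 ix +
    \sum_(t <- e2) d t *: fun_IV qy qz t.1 t.2 ix = 0 by rewrite mmeasure0.
  rewrite -[RHS]sum0x; congr (_ + _).
    rewrite big_seq [RHS]big_seq; apply: eq_bigr => t te.
    by have /and3P[? ? ?] := we t te; rewrite fieldY_ix fieldZ_ix // !scaler0 !addr0.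
  by rewrite sum_ffunE; apply: eq_bigr => t _; rewrite fieldZE.
have a0 : {in e, forall t, a t = 0}.
  by move=> t te; apply: (CE (inl t)); rewrite mem_cat map_f.
have d0 : {in e2, forall t, d t = 0}.
  by move=> t te; apply: (CE (inr t)); rewrite mem_cat map_f ?orbT.
have S0 o : S o = 0.
  have := sum0' o; rewrite fieldDE [X in _ + X]sum_ffunE [RHS]ffunE [X in _ + X]big_seq.
  rewrite [X in _ + X]big1 ?addr0 // => t te.
  by rewrite fieldZE d0 // scale0r.
have b0 : {in e, forall t, b t = 0}.
  apply: (@free_mlead _ _ _ e (fun t => fieldY t.1.1 t.1.2 t.2 iy) b 0) => //.
  - by move=> t te; have /and3P[t1 t2 t3] := we t te; have [] := has_lead_fieldY t1 t2 t3.
  - move=> t u te ue'; have /and3P[t1 t2 t3] := we t te; have /and3P[u1 u2 u3] := we u ue'.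
    rewrite /= (has_lead_fieldY t1 t2 t3).2 (has_lead_fieldY u1 u2 u3).2.
    by move=> /mnm3_inj[? ? ?]; apply: triple_inj => //; lia.
  suff -> : \sum_(t <- e) b t *: fieldY t.1.1 t.1.2 t.2 iy = 0 by rewrite mmeasure0.
  rewrite -[RHS](S0 iy) SE big_seq [RHS]big_seq; apply: eq_bigr => t te.
  by have /and3P[? ? ?] := we t te; rewrite a0 // fieldZ_iy // scale0r scaler0 add0r addr0.
suff c0 : {in e, forall t, c t = 0} by split=> // t te; rewrite a0 ?b0 ?c0.
apply: (@free_mlead _ _ _ e (fun t => fieldZ t.1.1 t.1.2 t.2 iz) c 0) => //.
- by move=> t te; have /and3P[t1 t2 t3] := we t te; have [] := has_lead_fieldZ t1 t2 t3.
- move=> t u te ue'; have /and3P[t1 t2 t3] := we t te; have /and3P[u1 u2 u3] := we u ue'.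
  rewrite /= (has_lead_fieldZ t1 t2 t3).2 (has_lead_fieldZ u1 u2 u3).2.
  by move=> /mnm3_inj[? ? ?]; apply: triple_inj => //; lia.
suff -> : \sum_(t <- e) c t *: fieldZ t.1.1 t.1.2 t.2 iz = 0 by rewrite mmeasure0.
rewrite -[RHS](S0 iz) SE big_seq [RHS]big_seq; apply: eq_bigr => t te.
by rewrite a0 ?b0 // !scale0r !add0r.
Qed.

(** * Index sequences and the concatenated families *)

Definition idx3 n : seq T3 :=
  [seq (val t.1.1, val t.1.2, val t.2) | t <- enum (index3 n)].

Definition idx2 n : seq T2 := [seq (val t.1, val t.2) | t <- enum (index2 n)].

Lemma mem_idx3 n (t : T3) : (t \in idx3 n) = wf3 t && (t.1.1 + t.1.2 + t.2 <= n)%N.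
Proof.
case: t => [[i j] k]; apply/mapP/andP => /= [[u]|[/and3P[/= i2 j1 k1] le_n]].
  rewrite mem_enum inE => /and4P[u1 u2 u3 u4] [-> -> ->].
  by split=> //; apply/and3P.
have [ilt [jlt klt]] : (i < n.+1 /\ j < n.+1 /\ k < n.+1)%N by lia.
exists (Ordinal ilt, Ordinal jlt, Ordinal klt) => //.
by rewrite mem_enum inE; apply/and4P.
Qed.

Lemma mem_idx2 n (t : T2) : (t \in idx2 n) = wf2 t && (t.1 + t.2 <= n)%N.
Proof.
case: t => [j k]; apply/mapP/andP => /= [[u]|[/andP[/= j1 k1] le_n]].
  rewrite mem_enum inE => /and3P[u1 u2 u3] [-> ->].
  by split=> //; apply/andP.
have [jlt klt] : (j < n.+1 /\ k < n.+1)%N by lia.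
exists (Ordinal jlt, Ordinal klt) => //.
by rewrite mem_enum inE; apply/and3P.
Qed.

Lemma idx3_uniq n : uniq (idx3 n).
Proof.
rewrite map_inj_uniq ?enum_uniq // => [[[i j] k]] [[i' j'] k'] /= [ei ej ek].
by congr (_, _, _); apply: val_inj.
Qed.

Lemma idx2_uniq n : uniq (idx2 n).
Proof.
rewrite map_inj_uniq ?enum_uniq // => [[j k]] [j' k'] /= [ej ek].
by congr (_, _); apply: val_inj.
Qed.

Local Notation J := ((T3 + T3) + (T3 + T2))%type.

(** The tags keep the indices of the four types apart, so that their uniqueness does not presuppose
    distinct fields. *)
Definition fam (x : J) : field3 :=
  match x with
  | inl (inl t) => fun_I qx qy qz t.1.1 t.1.2 t.2
  | inl (inr t) => fun_II qx qy qz t.1.1 t.1.2 t.2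
  | inr (inl t) => fun_III qx qy qz t.1.1 t.1.2 t.2
  | inr (inr t) => fun_IV qy qz t.1 t.2
  end.

(** Only type I is bounded by [n]: the second kind space takes [n = p], the first kind space
    [n = p.-1]. *)
Definition fam_idx n (p : nat) : seq J :=
  [seq inl (inl t) | t <- idx3 n] ++ [seq inl (inr t) | t <- idx3 p] ++
  [seq inr (inl t) | t <- idx3 p] ++ [seq inr (inr t) | t <- idx2 (p - 2)].

Lemma map_fam n (p : nat) : map fam (fam_idx n p) =
  family3 (fun_I qx qy qz) n ++ family3 (fun_II qx qy qz) p ++
  family3 (fun_III qx qy qz) p ++ family2 (fun_IV qy qz) (p - 2).
Proof.
rewrite /fam_idx 3!map_cat.
congr (_ ++ (_ ++ (_ ++ _))); rewrite -map_comp -[LHS]map_comp; exact: erefl.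
Qed.

Lemma mem_fam_idx n (p : nat) (x : J) : (x \in fam_idx n p) =
  match x with
  | inl (inl t) => t \in idx3 n
  | inl (inr t) | inr (inl t) => t \in idx3 p
  | inr (inr t) => t \in idx2 (p - 2)
  end.
Proof.
have injm (T U : eqType) (k : T -> U) (s : seq T) x' : injective k ->
  (k x' \in map k s) = (x' \in s) by move=> kI; rewrite mem_map.
have notm (T U : eqType) (k : T -> U) (s : seq T) x' :
  (forall t, k t <> x') -> (x' \in map k s) = false.
  by move=> kx; apply/negbTE/mapP => -[t _ /esym/kx].
rewrite /fam_idx; move: (idx3 n) (idx3 p) (idx2 _) => s1 s2 s3; rewrite !mem_cat.
case: x => [[t|t]|[t|t]].
- by rewrite (@injm _ _ (fun t => inl (inl t))) ?notm ?orbF // => ? ? [].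
- by rewrite (@injm _ _ (fun t => inl (inr t))) ?notm ?orbF // => ? ? [].
- by rewrite (@injm _ _ (fun t => inr (inl t))) ?notm ?orbF // => ? ? [].
- by rewrite (@injm _ _ (fun t => inr (inr t))) ?notm ?orbF // => ? ? [].
Qed.

Lemma fam_idx_uniq n (p : nat) : uniq (fam_idx n p).
Proof.
have disj (T U V : eqType) (k : T -> V) (l : U -> V) (s : seq T) (s' : seq U) :
  (forall t u, k t <> l u) -> ~~ has (mem (map k s)) (map l s').
  move=> kl; apply/hasPn => x /mapP[u _ ->]; apply/mapP => -[t _ /esym].
  exact: kl.
move: (idx3_uniq n) (idx3_uniq p) (idx2_uniq (p - 2)); rewrite /fam_idx.
move: (idx3 n) (idx3 p) (idx2 _) => s1 s2 s3 u1 u2 u3.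
rewrite !cat_uniq !has_cat !negb_or !map_inj_uniq ?u1 ?u2 ?u3 ?disj //;
  by move=> ? ? [].
Qed.

Lemma sum_fam n (p : nat) (c : J -> R) : \sum_(x <- fam_idx n p) c x *: fam x =
  \sum_(t <- idx3 n) c (inl (inl t)) *: fun_I qx qy qz t.1.1 t.1.2 t.2 +
  (\sum_(t <- idx3 p) c (inl (inr t)) *: fun_II qx qy qz t.1.1 t.1.2 t.2 +
  (\sum_(t <- idx3 p) c (inr (inl t)) *: fun_III qx qy qz t.1.1 t.1.2 t.2 +
   \sum_(t <- idx2 (p - 2)) c (inr (inr t)) *: fun_IV qy qz t.1 t.2)).
Proof.
rewrite /fam_idx; move: (idx3 n) (idx3 p) (idx2 _) => s1 s2 s3.
by rewrite 3!big_cat; congr (_ + (_ + (_ + _))); apply: big_map.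
Qed.

(** * Change of basis to types I, II and III *)

Lemma fields_combination (V : lmodType R) (x y z : V) (a b d i j k : R) :
  (a + j * b + k * d) *: x + (a - i * b) *: y + (a - i * d) *: z =
  a *: (x + y + z) + b *: (j *: x - i *: y) + d *: (k *: x - i *: z).
Proof.
rewrite !scalerDl !scalerDr !scalerN !scaleNr !scalerA ![b * _]mulrC ![d * _]mulrC.
by rewrite [LHS](AC (3*2*2) (((1*4*6)*(2*5))*(3*7))).
Qed.

(** This inverts the change of basis, whose determinant is [i * (i + j + k)]: once [x] is recovered,
    types II and III give [y] and [z]. *)
Lemma fields_sum (V : lmodType R) (x y z : V) (i j k : R) :
  (i + j + k) *: x = i *: (x + y + z) + (j *: x - i *: y) + (k *: x - i *: z).
Proof.
have := fields_combination x y z i 1 1 i j k.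
by rewrite !mulr1 subrr !scale0r !addr0 !scale1r.
Qed.

Lemma fam_free (p : nat) : lin_free fam (fam_idx p p).
Proof.
move=> c; rewrite sum_fam !addrA -!big_split => c0.
pose a t := c (inl (inl t)); pose b t := c (inl (inr t)); pose d t := c (inr (inl t)).
have [] := @fields_free (idx3 p) (idx2 (p - 2))
  (fun t => a t + t.1.2%:R * b t + t.2%:R * d t)
  (fun t => a t - t.1.1%:R * b t) (fun t => a t - t.1.1%:R * d t) (fun t => c (inr (inr t))).
- exact: idx3_uniq.
- exact: idx2_uniq.
- by move=> t; rewrite mem_idx3 => /andP[].
- by move=> t; rewrite mem_idx2 => /andP[].
- apply: etrans c0; apply: (f_equal2 +%R); last exact: erefl.
  apply: eq_bigr => t _.
  rewrite fun_IE fun_IIE fun_IIIE; exact: fields_combination.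
move=> abd0 e0.
have abd : {in idx3 p, forall t, [/\ a t = 0, b t = 0 & d t = 0]}.
  move=> t te; have [X0 Y0 Z0] := abd0 t te.
  move: te; rewrite mem_idx3 => /andP[/and3P[i2 j1 k1] _].
  have i0 : t.1.1%:R != 0 :> R by rewrite pnatr_eq0 -lt0n ltnW.
  have s0 : (t.1.1 + t.1.2 + t.2)%:R != 0 :> R.
    by rewrite pnatr_eq0 -lt0n !addn_gt0 (ltnW i2).
  have ib : t.1.1%:R * b t = a t by apply/esym/subr0_eq.
  have id : t.1.1%:R * d t = a t by apply/esym/subr0_eq.
  (* Multiplying the first relation by [i] and using [i * b = a] and [i * d = a] yields
     [(i + j + k) * a = 0]. *)
  have a0 : a t = 0.
    apply: (mulfI s0); rewrite mulr0 -[RHS](mulr0 t.1.1%:R) -X0 !mulrDr.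
    by rewrite [_ * (_ * b t)]mulrCA [_ * (_ * d t)]mulrCA ib id !natrD; ring.
  split=> //; apply: (mulfI i0); rewrite mulr0; [by rewrite ib | by rewrite id].
move=> [[t|t]|[t|t]]; rewrite mem_fam_idx => te; last exact: e0.
- by have [] := abd t te.
- by have [] := abd t te.
- by have [] := abd t te.
Qed.

Lemma fam_fields_span (p : nat) i j k : wf3 (i, j, k) -> (i + j + k <= p)%N ->
  [/\ in_span fam (fam_idx p p) (fieldX i j k), in_span fam (fam_idx p p) (fieldY i j k)
    & in_span fam (fam_idx p p) (fieldZ i j k)].
Proof.
move=> wf le_p; have mem : (i, j, k) \in idx3 p by rewrite mem_idx3 wf.
have [/= i2 j1 k1] := and3P wf.
have s0 : (i + j + k)%:R != 0 :> R by rewrite pnatr_eq0 -lt0n !addn_gt0 (ltnW i2).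
have i0 : i%:R != 0 :> R by rewrite pnatr_eq0 -lt0n ltnW.
have sI : in_span fam (fam_idx p p) (fun_I qx qy qz i j k).
  by apply: (@in_span_mem _ _ _ fam _ (inl (inl (i, j, k)))); rewrite ?fam_idx_uniq ?mem_fam_idx.
have sII : in_span fam (fam_idx p p) (fun_II qx qy qz i j k).
  by apply: (@in_span_mem _ _ _ fam _ (inl (inr (i, j, k)))); rewrite ?fam_idx_uniq ?mem_fam_idx.
have sIII : in_span fam (fam_idx p p) (fun_III qx qy qz i j k).
  by apply: (@in_span_mem _ _ _ fam _ (inr (inl (i, j, k)))); rewrite ?fam_idx_uniq ?mem_fam_idx.
have sX : in_span fam (fam_idx p p) (fieldX i j k).
  have -> : fieldX i j k = (i + j + k)%:R^-1 *: (i%:R *: fun_I qx qy qz i j k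
      + fun_II qx qy qz i j k + fun_III qx qy qz i j k).
    apply: (scalerI s0); rewrite scalerA mulfV // scale1r fun_IE fun_IIE fun_IIIE.
    by rewrite !natrD; apply: fields_sum.
  by apply: in_spanZ; apply: in_spanD => //; apply: in_spanD => //; apply: in_spanZ.
split=> //.
- have -> : fieldY i j k = i%:R^-1 *: (j%:R *: fieldX i j k - fun_II qx qy qz i j k).
    by rewrite fun_IIE subKr scalerA mulVf // scale1r.
  by apply: in_spanZ; apply: in_spanB => //; apply: in_spanZ.
- have -> : fieldZ i j k = i%:R^-1 *: (k%:R *: fieldX i j k - fun_III qx qy qz i j k).
    by rewrite fun_IIIE subKr scalerA mulVf // scale1r.
  by apply: in_spanZ; apply: in_spanB => //; apply: in_spanZ.
Qed.

(** The bound [p.-1.+1] is [p], except that it is 1 for [p = 0]; no index arises in that case, since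
    [i + j + k] and [j + k + 2] are at least 4. *)
Lemma fam_span (p : nat) v : trace_free p.-1.+1 v -> in_span fam (fam_idx p p) v.
Proof.
apply: trace_free_ind => [|u w a su sw|i j k i2 j1 k1 le_p|j k j1 k1 le_p].
- exact: in_span0.
- by apply: in_spanD => //; apply: in_spanZ.
- by apply: fam_fields_span; [apply/and3P | lia].
- apply: (@in_span_mem _ _ _ fam _ (inr (inr (j, k)))); rewrite ?fam_idx_uniq ?mem_fam_idx //.
  by rewrite mem_idx2 /wf2 /= j1 k1 /=; lia.
Qed.

Lemma fam_trace_free n (p : nat) : (n <= p)%N ->
  {in fam_idx n p, forall x, trace_free p.-1.+1 (fam x)}.
Proof.
move=> np; have XYZ t m : t \in idx3 m -> (m <= p)%N ->
    [/\ trace_free p.-1.+1 (fieldX t.1.1 t.1.2 t.2),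
        trace_free p.-1.+1 (fieldY t.1.1 t.1.2 t.2)
      & trace_free p.-1.+1 (fieldZ t.1.1 t.1.2 t.2)].
  rewrite mem_idx3 => /andP[/and3P[i2 j1 k1] le_m] mp.
  have le_p := leq_trans le_m (leq_trans mp (leqSpred p)).
  by split; [apply: fieldX_trace_free | apply: fieldY_trace_free | apply: fieldZ_trace_free].
move=> [[t|t]|[t|t]]; rewrite mem_fam_idx => te.
- have [TX TY TZ] := XYZ t n te np.
  by rewrite /fam fun_IE; apply: trace_freeD => //; apply: trace_freeD.
- have [TX TY TZ] := XYZ t p te (leqnn p).
  by rewrite /fam fun_IIE; apply: trace_freeB; apply: trace_freeZ.
- have [TX TY TZ] := XYZ t p te (leqnn p).
  by rewrite /fam fun_IIIE; apply: trace_freeB; apply: trace_freeZ.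
- move: te; rewrite mem_idx2 => /andP[/andP[j1 k1] le_p].
  by apply: fun_IV_trace_free => //; lia.
Qed.

(** * The radial component and the first kind space *)

Definition radial v := dot (vec3 X Y Z) v.

Lemma radialE v : radial v = X * v ix + (Y * v iy + Z * v iz).
Proof. by rewrite /radial dotE !vec3E. Qed.

Lemma radialD v w : radial (v + w) = radial v + radial w.
Proof.
by rewrite /radial /dot -big_split; apply: eq_bigr => d _; rewrite fieldDE mulrDr.
Qed.

Lemma radialZ a v : radial (a *: v) = a *: radial v.
Proof.
by rewrite /radial /dot scaler_sumr; apply: eq_bigr => d _; rewrite fieldZE scalerAr.
Qed.

Lemma radialB v w : radial (v - w) = radial v - radial w.
Proof. by rewrite -scaleN1r radialD radialZ scaleN1r. Qed.

Lemma radial_sum (T : Type) (s : seq T) (F : T -> field3) :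
  radial (\sum_(t <- s) F t) = \sum_(t <- s) radial (F t).
Proof.
elim: s => [|t s IH]; last by rewrite !big_cons radialD IH.
by rewrite !big_nil radialE !ffunE !mulr0 !addr0.
Qed.

Lemma pmul1 v : pmul 1 v = v.
Proof. by apply/ffunP => d; rewrite pmulE mul1r. Qed.

Lemma radial_pmul_grad q u : radial (pmul q (grad u)) = q * euler u.
Proof.
rewrite radialE !pmulE !gradE /euler big_ord3 !mulrDr.
by congr (_ + (_ + _)); apply: mulrCA.
Qed.

(** The part of degree [k + 1] of the radial component of [v] comes from the part of degree [k] of
    [v] alone, so the size bound says that this part is orthogonal to the position vector. *)
Lemma nedelec1P k v :
  nedelec1 k v <-> nedelec2 k v /\ (msize (radial v) <= k.+1)%N.
Proof.
have radial_msize (u : field3) m : (forall d, msize (u d) <= m)%N -> (msize (radial u) <= m.+1)%N.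
  move=> um; have Xu (o : 'I_3) d : (msize ('X_o * u d : poly3) <= m.+1)%N.
    by rewrite mulrC -[m.+1]addn1; apply: msizeM_leq => //; rewrite msizeX mdeg1.
  by rewrite radialE; apply: msizeD_leq; [|apply: msizeD_leq]; apply: Xu.
split=> [[u [w [uk [wk w0] ->]]]|[vk rv]].
  split; last by rewrite radialD [radial w]w0 addr0; apply: radial_msize.
  move=> d; rewrite fieldDE; apply: msizeD_leq; first exact: leq_trans (uk d) _.
  exact: dhomog_msize_leq.
pose w : field3 := [ffun d => pihomog mdeg k (v d)].
have wE d : w d = pihomog mdeg k (v d) by rewrite ffunE.
have uk d : (msize ((v - w) d) <= k)%N by rewrite fieldBE wE; apply: msize_pihomog.
exists (v - w), w; split=> //; last by rewrite subrK.
have wk d : w d \is k.-homog by rewrite wE; apply: pihomogP.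
split=> //; apply: (@dhomog_msize_eq0 _ _ _ k.+1).
  have Xw (o : 'I_3) d : 'X_o * w d \is k.+1.-homog.
    by rewrite -[k.+1]add1n; apply: dhomogM => //; rewrite dhomogX; apply/eqP/mdeg1.
  by rewrite -/(radial w) radialE; do !apply: dhomogD; apply: Xw.
rewrite -/(radial w); have -> : radial w = radial v - radial (v - w).
  by rewrite -radialB subKr.
by apply: msizeB_leq => //; apply: radial_msize.
Qed.

Lemma euler_msize_leq k q : (msize q <= k.+1)%N -> (msize (euler q) <= k.+1)%N.
Proof.
move=> qk; rewrite -[euler q](subrK (k%:R *: q)).
apply: msizeD_leq; last exact: msizeZ_leq.
exact/leqW/euler_homog.
Qed.

Section RadialSizes.
Variables i j k : nat.
Hypotheses (i2 : (2 <= i)%N) (j1 : (1 <= j)%N) (k1 : (1 <= k)%N).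
Let sf := msize_f i2.
Let sg := msize_g i2 j1.
Let sh := msize_h i2 j1 k1.

Lemma msize_potential : msize (f i * g i j * h i j k) = (i + j + k).+1.
Proof. by rewrite (has_lead_msize (has_lead_potential i2 j1 k1)) mdeg_mnm3 addnA. Qed.

Lemma radial_fun_I : radial (fun_I qx qy qz i j k) = euler (f i * g i j * h i j k).
Proof. by rewrite -[euler _]mul1r -radial_pmul_grad pmul1. Qed.

(* In the radial direction the two gradients cancel up to Euler's identity for
   the homogeneous leading parts. *)
Lemma radial_fun_II : (msize (radial (fun_II qx qy qz i j k)) <= i + j + k)%N.
Proof.
have -> : radial (fun_II qx qy qz i j k) =
    j%:R *: ((euler (f i) - i%:R *: f i) * g i j * h i j k)
    - i%:R *: ((euler (g i j) - j%:R *: g i j) * f i * h i j k).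
  rewrite fun_IIE radialB !radialZ !radial_pmul_grad -!mul_mpolyC; ring.
have ef := euler_homog (eq_leq sf); have eg := euler_homog (eq_leq sg).
apply: msizeB_leq; apply: msizeZ_leq.
  by apply: msizeM_leq; [apply: msizeM_leq | rewrite sh]; rewrite ?sg.
rewrite [(i + j)%N]addnC.
by apply: msizeM_leq; [apply: msizeM_leq | rewrite sh]; rewrite ?sf.
Qed.

Lemma radial_fun_III : (msize (radial (fun_III qx qy qz i j k)) <= i + j + k)%N.
Proof.
have -> : radial (fun_III qx qy qz i j k) =
    k%:R *: ((euler (f i) - i%:R *: f i) * g i j * h i j k)
    - i%:R *: ((euler (h i j k) - k%:R *: h i j k) * f i * g i j).
  rewrite fun_IIIE radialB !radialZ !radial_pmul_grad -!mul_mpolyC; ring.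
have ef := euler_homog (eq_leq sf); have eh := euler_homog (eq_leq sh).
apply: msizeB_leq; apply: msizeZ_leq.
  by apply: msizeM_leq; [apply: msizeM_leq | rewrite sh]; rewrite ?sg.
rewrite -addnA addnC addnAC.
have -> : (j + i + k = k + i + j)%N by lia.
by apply: msizeM_leq; [apply: msizeM_leq | rewrite sg]; rewrite ?sf.
Qed.

End RadialSizes.

(** Euler's identity leaves a constant [r m] beyond [bary m] itself. In the antisymmetric Whitney
    form the products of the two coordinates cancel, and only terms of degree at most 1 remain next
    to [g] and [h]. *)
Lemma radial_fun_IV j k : (1 <= j)%N -> (1 <= k)%N ->
  (msize (radial (fun_IV qy qz j k)) <= j + k + 2)%N.
Proof.
move=> j1 k1.
have sb m : (msize (bary R m) <= 2)%N.
  by rewrite (has_lead_msize (has_lead_bary R m)) mdeg1.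
pose r m := euler (bary R m) - 1 *: bary R m.
have sr m : (msize (r m) <= 1)%N by apply: (@euler_homog _ _ _ 1).
have -> : radial (fun_IV qy qz j k) =
    g 1 j * h 1 j k * (r face0 * bary R face1 - r face1 * bary R face0).
  have pmulM (a b : poly3) v : pmul a (pmul b v) = pmul (a * b) v.
    by apply/ffunP => d; rewrite !pmulE mulrA.
  have pmulB (a : poly3) v w : pmul a (v - w) = pmul a v - pmul a w.
    by apply/ffunP => d; rewrite fieldBE !pmulE fieldBE mulrBr.
  rewrite /fun_IV edge_fun12E pmulB radialB !pmulM !radial_pmul_grad /r !scale1r.
  by move: (bary R face0) (bary R face1) => b0 b1; ring.
have -> : (j + k + 2 = j.+1 + k + 1)%N by lia.
apply: msizeM_leq; last first.
  by apply: msizeB_leq; apply: (@msizeM_leq _ _ _ _ 1 1).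
apply: msizeM_leq.
  by rewrite (has_lead_msize (@has_lead_g 1 j _ j1)) // mdeg_mnm3 addn0.
by rewrite (has_lead_msize (@has_lead_h 1 j k _ j1 k1)) // mdeg_mnm3.
Qed.

Lemma fam_radial (p : nat) (x : J) : x \in fam_idx p.-1 p ->
  (msize (radial (fam x)) <= p.-1.+1)%N.
Proof.
case: x => [[t|t]|[t|t]]; rewrite mem_fam_idx ?mem_idx3 ?mem_idx2.
- move=> /andP[/and3P[i2 j1 k1] le_p]; rewrite /fam radial_fun_I.
  by apply: euler_msize_leq; rewrite msize_potential.
- move=> /andP[/and3P[i2 j1 k1] le_p].
  exact: leq_trans (radial_fun_II i2 j1 k1) (leq_trans le_p (leqSpred p)).
- move=> /andP[/and3P[i2 j1 k1] le_p].
  exact: leq_trans (radial_fun_III i2 j1 k1) (leq_trans le_p (leqSpred p)).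
- move=> /andP[/andP[j1 k1] le_p]; apply: leq_trans (radial_fun_IV j1 k1) _.
  by move: j1 k1 le_p; case: t => [j k] /=; lia.
Qed.

Lemma interior_nedelec1P k v : interior (@nedelec1 R k) v <->
  trace_free k.+1 v /\ (msize (radial v) <= k.+1)%N.
Proof.
rewrite /interior nedelec1P zero_tangential_traceP /trace_free.
by split=> [[[? ?] ?]|[[? ?] ?]].
Qed.

(* The radial component of [fun_I] has the full degree [i + j + k], so the
   fields with [i + j + k = p] are excluded from the first kind space. *)
Lemma fam_span1 (p : nat) v : trace_free p.-1.+1 v -> (msize (radial v) <= p.-1.+1)%N ->
  in_span fam (fam_idx p.-1 p) v.
Proof.
(* For [p = 0] the predecessor is [p] itself and the two families coincide. *)
case: p => [|p /=] Tv rv; first exact: fam_span.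
have [c def_v] := fam_span (p := p.+1) Tv.
pose F (t : T3) := f t.1.1 * g t.1.1 t.1.2 * h t.1.1 t.1.2 t.2.
have top0 : {in idx3 p.+1, forall t, t \notin idx3 p -> c (inl (inl t)) = 0}.
  pose e := [seq t <- idx3 p.+1 | t \notin idx3 p].
  have eP t : t \in e -> wf3 t /\ (t.1.1 + t.1.2 + t.2 = p.+1)%N.
    rewrite mem_filter !mem_idx3 => /andP[+ /andP[wt le_p]]; rewrite wt /= -ltnNge => lt_p.
    by split=> //; apply/eqP; rewrite eqn_leq le_p.
  have leadF t : t \in e -> has_lead (F t) (mnm3 t.1.1 t.1.2 t.2).
    by move=> /eP[/and3P[? ? ?] _]; apply: has_lead_potential.
  suff H : {in e, forall t, c (inl (inl t)) * p.+1%:R = 0}.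
    move=> t te tp; have /H/eqP : t \in e by rewrite mem_filter tp.
    by rewrite mulf_eq0 pnatr_eq0 orbF => /eqP.
  apply: (@free_mlead _ _ _ e F (fun t => c (inl (inl t)) * p.+1%:R) p.+1).
  - by rewrite filter_uniq ?idx3_uniq.
  - by move=> t /leadF[].
  - move=> t u te ue /=; rewrite (leadF t te).2 (leadF u ue).2 => /mnm3_inj[? ? ?].
    exact: triple_inj.
  - by move=> t te /=; rewrite (leadF t te).2 mdeg_mnm3 addnA (eP t te).2.
  (* By Euler's identity the radial component of a top degree gradient is [p.+1] times its potential
     up to lower degree. [G] collects these multiples, and all other radial components already have
     lower degree. *)
  pose G x := if x is inl (inl t) then
      if t \in idx3 p then 0 else c x *: (p.+1%:R *: F t)
    else 0.
  have GE : \sum_(t <- e) (c (inl (inl t)) * p.+1%:R) *: F t =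
      \sum_(x <- fam_idx p.+1 p.+1) G x.
    have G0 (T : eqType) (s : seq T) (o : T -> J) :
        (forall t, G (o t) = 0) -> \sum_(x <- map o s) G x = 0.
      by move=> o0; rewrite big_map big1.
    rewrite /fam_idx 3!big_cat /= [X in _ + X](_ : _ = 0); last by rewrite /= !G0 ?addr0.
    rewrite /= addr0 [RHS](big_map (fun t => inl (inl t))) -/(idx3 p.+1).
    rewrite big_filter big_mkcond; apply: eq_bigr => t _.
    by rewrite /G; case: (t \in idx3 p); rewrite //= scalerA.
  have -> : \sum_(t <- e) (c (inl (inl t)) * p.+1%:R) *: F t =
      radial v - \sum_(x <- fam_idx p.+1 p.+1) (c x *: radial (fam x) - G x).
    have rE : radial v = \sum_(x <- fam_idx p.+1 p.+1) c x *: radial (fam x).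
      by rewrite def_v radial_sum; apply: eq_bigr => x _; apply: radialZ.
    by rewrite GE sumrB -rE subKr.
  apply: msizeB_leq => //; rewrite big_seq; apply: msize_sum_leq => x xp.
  have low : x \in fam_idx p p.+1 -> (msize (radial (fam x)) <= p.+1)%N.
    exact: (@fam_radial p.+1).
  case: x xp low => [[t|t]|[t|t]]; rewrite /G !mem_fam_idx => tp low;
    rewrite ?subr0; try exact/msizeZ_leq/low.
  case: ifPn => tp'; first by rewrite subr0; apply/msizeZ_leq/low.
  rewrite -scalerBr; apply: msizeZ_leq.
  have [/and3P[i2 j1 k1] te] : wf3 t /\ (t.1.1 + t.1.2 + t.2 = p.+1)%N.
    by apply: eP; rewrite mem_filter tp'.
  rewrite /fam radial_fun_I -te; apply: euler_homog.
  by rewrite msize_potential.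
exists c; rewrite def_v !sum_fam; congr (_ + _).
rewrite (bigID (fun t => t \in idx3 p)) /= [X in _ + X]big1_seq ?addr0; last first.
  by move=> t /andP[tp te]; rewrite top0 // scale0r.
rewrite -big_filter; apply: perm_big; apply: uniq_perm.
- by rewrite filter_uniq ?idx3_uniq.
- exact: idx3_uniq.
move=> t; rewrite mem_filter !mem_idx3; case: (wf3 t) => //=.
by case: leqP => //= le_p; rewrite leqW.
Qed.

(** * The two bases *)

Lemma nedelec2_basis (p : nat) : is_basis (interior (@nedelec2 R p.-1)) (map fam (fam_idx p p)).
Proof.
apply: is_basis_map => [|x xp||v Iv].
- exact: fam_idx_uniq.
- by apply/interior_nedelec2P; apply: (fam_trace_free (leqnn p)).
- exact: fam_free.
- by apply/fam_span/interior_nedelec2P.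
Qed.

Lemma nedelec1_basis (p : nat) : is_basis (interior (@nedelec1 R p.-1)) (map fam (fam_idx p.-1 p)).
Proof.
apply: is_basis_map => [|x xp||v /interior_nedelec1P[Tv rv]].
- exact: fam_idx_uniq.
- apply/interior_nedelec1P; split; last exact: fam_radial.
  exact: (fam_trace_free (leq_pred p)).
- apply: lin_free_sub (fam_free (p := p)); try exact: fam_idx_uniq.
  move=> [[t|t]|[t|t]]; rewrite !mem_fam_idx //.
  rewrite !mem_idx3 => /andP[-> le_p] /=; exact: leq_trans le_p (leq_pred p).
- exact: fam_span1.
Qed.

End ShapeFunctions.

Theorem theorem3p6 (R : realType)
    (qx : nat -> {poly R}) (qy : nat -> nat -> {poly R})
    (qz : nat -> nat -> nat -> {poly R})
    (qx_deg : forall i, (2 <= i)%N -> exact_degree i (qx i))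
    (qx_root : forall i, (2 <= i)%N -> (qx i).[1] = 0 /\ (qx i).[-1] = 0)
    (qy_deg : forall i j, (1 <= i)%N -> (1 <= j)%N -> exact_degree j (qy i j))
    (qy_root : forall i j, (1 <= i)%N -> (1 <= j)%N -> (qy i j).[-1] = 0)
    (qz_deg : forall i j k, (1 <= i)%N -> (1 <= j)%N -> (1 <= k)%N ->
       exact_degree k (qz i j k))
    (qz_root : forall i j k, (1 <= i)%N -> (1 <= j)%N -> (1 <= k)%N ->
       (qz i j k).[-1] = 0)
    (qx_D : forall i, (2 <= i)%N -> property_D (qx i))
    (qy_D : forall i j, (1 <= i)%N -> (1 <= j)%N -> property_D (qy i j))
    (qz_D : forall i j k, (1 <= i)%N -> (1 <= j)%N -> (1 <= k)%N ->
       property_D (qz i j k))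
    (p : nat) :
  is_basis (interior (@nedelec2 R p.-1))
    (family3 (fun_I qx qy qz) p
     ++ family3 (fun_II qx qy qz) p
     ++ family3 (fun_III qx qy qz) p
     ++ family2 (fun_IV qy qz) (p - 2)) /\
  is_basis (interior (@nedelec1 R p.-1))
    (family3 (fun_I qx qy qz) p.-1
     ++ family3 (fun_II qx qy qz) p
     ++ family3 (fun_III qx qy qz) p
     ++ family2 (fun_IV qy qz) (p - 2)).
Proof.
rewrite -!map_fam; split; first exact: nedelec2_basis.
exact: nedelec1_basis.
Qed.
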